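(* Let $\mathcal{D} = \{(T_\theta, f_\theta) : \theta \in \Theta\}$ be a continuous family of dynamical models on a compact metric space $\mathcal{X}$, and let $\boldsymbol{\varepsilon} = (\varepsilon_k)_{k\ge0}$ be a real-valued i.i.d. process with mean zero and finite variance. If $h(\mathcal{D}) = 0$, then $\kappa(\mathcal{D} : \boldsymbol{\varepsilon}) = 0$. Moreover, the Gaussian mean width satisfies $\kappa_G(\mathcal{D}) = 0$ if and only if $h(\mathcal{D}) = 0$.
   Context: **Dynamical models.** Let $\mathcal{X}$ be a (nonempty) compact metric space. A continuous family of dynamical models on $\mathcal{X}$ is an indexed family $\mathcal{D} = \{(T_\theta, f_\theta) : \theta \in \Theta\}$ of maps $T_\theta : \mathcal{X} \to \mathcal{X}$ and $f_\theta : \mathcal{X} \to \mathbb{R}$ such that $\Theta$ is a (nonempty) compact metric space, the map $(\theta, x) \mapsto T_\theta(x)$ from $\Theta \times \mathcal{X}$ to $\mathcal{X}$ is continuous, and the map $(\theta,x) \mapsto f_\theta(x)$ from $\Theta \times \mathcal{X}$ to $\mathbb{R}$ is continuous. $T_\theta^k$ is the $k$-fold composition of $T_\theta$ ($T_\theta^0 = \mathrm{Id}$). **Mean width.** For an i.i.d. process $\boldsymbol{\varepsilon}$ with mean zero and finite variance, $$\kappa_n(\mathcal{D}:\boldsymbol{\varepsilon}) = \mathbb{E}\Bigl[\sup_{x\in\mathcal{X},\,\theta\in\Theta} \sum_{k=0}^{n-1} f_\theta\circ T_\theta^k(x)\cdot\varepsilon_k\Bigr], \qquad \kappa(\mathcal{D}:\boldsymbol{\varepsilon})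 = \lim_n \frac1n \kappa_n(\mathcal{D}:\boldsymbol{\varepsilon}),$$ where the limit exists by subadditivity. The Gaussian mean width $\kappa_G(\mathcal{D})$ is $\kappa(\mathcal{D}:\boldsymbol{\varepsilon})$ in the case $\varepsilon_i \sim N(0,1)$. **Entropy of a family.** With $\mathbb{N}=\{0,1,2,\dots\}$, for $\mathbf{u},\mathbf{v} \in \mathbb{R}^{\mathbb{N}}$ let $d_{n,p}(\mathbf{u},\mathbf{v}) = (n^{-1}\sum_{k=0}^{n-1}|u_k-v_k|^p)^{1/p}$ for $1\le p<\infty$ and $d_{n,\infty}(\mathbf{u},\mathbf{v}) = \max_{0 \leq k \leq n-1}|u_k-v_k|$. For $\mathcal{U} \subseteq \mathbb{R}^{\mathbb{N}}$ let $N(\mathcal{U},r,d_{n,p})$ be the covering number of $\mathcal{U}$ at radius $r$ under $d_{n,p}$, $h_p(\mathcal{U},r) = \limsup_n \frac1n \log N(\mathcal{U},r,d_{n,p})$, and $h_p(\mathcal{U}) = \lim_{r\searrow 0} h_p(\mathcal{U},r)$. The value $h_p(\mathcal{U})$ does not depend on $p \in [1,\infty]$. The entropy $h(\mathcal{D})$ is the common value of $h_p(\mathcal{U}_{\mathcal{D}})$, where $\mathcal{U}_{\mathcal{D}} = \{(f_\theta\circ T_\theta^k(x))_{k\ge0} : x \in \mathcal{X}, \theta\in\Theta\}$. *)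

(* Defs.v *)
From HB Require Import structures.
From mathcomp Require Export all_boot all_order all_algebra finmap.
From mathcomp Require Export all_classical all_reals all_analysis.
Export Order.TTheory GRing.Theory Num.Theory.
Export numFieldNormedType.Exports.

Set Implicit Arguments.
Unset Strict Implicit.
Unset Printing Implicit Defensive.

Local Open Scope classical_set_scope.
Local Open Scope ring_scope.

(** Continuous families of dynamical models *)

Record dynFamily (R : realType) (Theta X : metricType R) := DynFamily {
  dyn_map : Theta -> X -> X;
  dyn_obs : Theta -> X -> R;
  dyn_map_continuous :
    continuous (fun z : Theta * X => dyn_map z.1 z.2);
  dyn_obs_continuous :
    continuous (fun z : Theta * X => dyn_obs z.1 z.2) }.

Section family.
Context (R : realType) (Theta X : metricType R) (D : dynFamily Theta X).

Definition orbit_seq (theta : Theta) (x : X) : nat -> R :=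
  fun k => dyn_obs D theta (iter k (dyn_map D theta) x).

Definition orbit_seqs : set (nat -> R) :=
  [set u | exists theta x, u = orbit_seq theta x].

End family.

(** Entropy of a set of real sequences *)

Section entropy.
Context (R : realType).
Implicit Types (u v : nat -> R) (U : set (nat -> R)) (p : \bar R) (r : R).

(* Only meaningful for [1 <= p]; the value at [-oo] is irrelevant. *)
Definition seq_dist (n : nat) p u v : R :=
  match p with
  | q%:E => (n%:R^-1 * \sum_(k < n) `|u k - v k| `^ q) `^ q^-1
  | _ => \big[Num.max/0]_(k < n) `|u k - v k|
  end.

(* Least number of open balls covering [U], with centers anywhere in the ambient
   space [nat -> R]; it is [+oo] when no finite cover exists. *)
Definition covering_number U r (n : nat) p : \bar R :=
  ereal_inf [set (m%:R)%:E | m in [set m : nat |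
    exists c : 'I_m -> nat -> R,
      U `<=` \bigcup_i [set u | seq_dist n p (c i) u < r]]].

Definition entropy_at U p r : \bar R :=
  limn_esup (fun n => ((n%:R^-1)%:E * lne (covering_number U r n p))%E).

Definition seq_entropy U p : \bar R := lim (entropy_at U p r @[r --> 0^'+]).

Lemma covering_number_ge0 U r n p : (0 <= covering_number U r n p)%E.
Proof. by apply: le_ereal_inf_tmp => _ [m _ <-]; rewrite lee_fin. Qed.

Lemma covering_number_anti U n p r s : r <= s ->
  (covering_number U s n p <= covering_number U r n p)%E.
Proof.
move=> rs; apply: ereal_inf_le_tmp => _ [m [c Uc] <-]; exists m => //; exists c.
move=> u /Uc [i _ /= ui]; exists i => //=; exact: lt_le_trans ui rs.
Qed.

(* The limit defining [seq_entropy] always exists in the extended reals. *)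
Lemma is_cvg_entropy_at U p : cvg (entropy_at U p r @[r --> 0^'+]).
Proof.
apply: nonincreasing_at_right_is_cvge; near=> b => r s _ _ rs.
rewrite /entropy_at !limn_esup_lim; apply: lee_lim.
- exact: is_cvg_esups.
- exact: is_cvg_esups.
apply: nearW => n; apply: ge_ereal_sup => _ [k nk <-].
apply: (@le_trans _ _ ((k%:R^-1)%:E * lne (covering_number U r k p))%E).
  apply: lee_wpmul2l; first by rewrite lee_fin.
  by rewrite lee_lne ?in_itv/= ?covering_number_ge0 ?leey// covering_number_anti.
by apply: ereal_sup_ubound; exists k.
Unshelve. all: by end_near. Qed.

End entropy.

(* [h_p] for the sequences generated by [D]; it does not depend on [p] in
   [[1, +oo]], and its common value is the entropy of the family. *)
Definition dyn_entropy (R : realType) (Theta X : metricType R)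
  (D : dynFamily Theta X) (p : \bar R) : \bar R :=
  seq_entropy (orbit_seqs D) p.

(** I.i.d. processes *)

Section iid.
Context (d : measure_display) (Omega : measurableType d) (R : realType).
Context (P : probability Omega R).
Local Open Scope ereal_scope.

Definition mutually_independent (eps : nat -> {RV P >-> R}) : Prop :=
  forall (J : {fset nat}) (A : nat -> set R),
    (forall k, measurable (A k)) ->
    P (\bigcap_(k in [set` J]) (eps k @^-1` A k)) =
    \prod_(k <- J) P (eps k @^-1` A k).

Definition identically_distributed (eps : nat -> {RV P >-> R}) : Prop :=
  forall (j k : nat) (A : set R), measurable A ->
    distribution P (eps j) A = distribution P (eps k) A.

Definition iid (eps : nat -> {RV P >-> R}) : Prop :=
  mutually_independent eps /\ identically_distributed eps.

Definition standard_normal (Y : {RV P >-> R}) : Prop :=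
  forall A : set R, measurable A ->
    distribution P Y A = normal_prob 0%R 1%R A.

End iid.

(** Mean width *)

Section mean_width.
Context (R : realType) (Theta X : metricType R) (D : dynFamily Theta X).
Context (d : measure_display) (Omega : measurableType d).
Context (P : probability Omega R) (eps : nat -> {RV P >-> R}).

Definition width (n : nat) (w : Omega) : R :=
  sup [set s | exists (x : X) (theta : Theta),
    s = \sum_(k < n) orbit_seq D theta x k * eps k w].

Definition mean_width_upto (n : nat) : \bar R := 'E_P[width n].

(* "kappa(D : eps) = kappa".  A relation is used rather than the operator [lim],
   whose value is arbitrary on divergent sequences. *)
Definition is_mean_width (kappa : \bar R) : Prop :=
  (fun n => ((n%:R^-1)%:E * mean_width_upto n)%E) @ \oo --> kappa.

End mean_width.

(* Main.v *)
Require Import Defs.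
From mathcomp Require Import all_boot all_order all_algebra finmap.
From mathcomp Require Import all_classical all_reals all_analysis.
From mathcomp Require Import measurable_realfun ring lra zify.

Set Implicit Arguments.
Unset Strict Implicit.
Unset Printing Implicit Defensive.
Local Open Scope classical_set_scope.
Local Open Scope ring_scope.

(** Only boundedness of the orbit sequences matters, so let [U] be a set of
    sequences bounded by [B].

    Zero entropy gives zero width: replace the noise by a function of it with
    finitely many values, close in [L1]. For a cover of [U] by [m] balls of
    [U]-centers [v_i] in [d_{n,1}], the supremum is at most the maximum over [i]
    of [sum_k v_i(k) eps_k] plus an error linear in [n] with a small factor, and
    exponential moments bound the mean of this maximum by
    [(ln m + 1) / lambda + O(lambda) n] for each small [lambda]; now [ln m = o(n)].

    Zero width gives zero entropy: round the sequences to levels of mesh [eta].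
    Take a maximal family of level words, any two of which are two or more levels
    apart at a positive proportion of the [n] coordinates. If it has subexponential
    size, then correcting its members at few coordinates gives a subexponential
    cover in [d_{n,oo}], which is the largest of the distances. If it has
    exponential size, a Sauer-Shelah argument for integer-valued functions yields
    a set [S] of at least [alpha n] coordinates shattered with gap [eta]: every
    sign pattern on [S] is realized by some [u] in [U] above or below fixed
    thresholds. Choosing [u] from the signs of [eps_k], [k] in [S], makes the mean
    supremum at least [(eta / 2) alpha n E|eps_0|], because the terms outside [S]
    have mean zero by independence. *)

(** * Sparse patterns and shattering *)

Section sparse.
Context {R : realType} {n : nat} {T : finType}.

(** A pattern is a partial word: its values serve as thresholds in shattering and as corrections to
    a center in the covers. *)
Definition patsupp (tau : {ffun 'I_n -> option T}) : {set 'I_n} :=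
  [set k | tau k != None]%SET.

(** Expand the power into a sum over patterns, each weighing [t] to the size of its support; as
    [t <= 1], a sparse pattern weighs at least [t ^+ m]. *)
Lemma card_sparse_patterns (t : R) m : 0 < t -> t <= 1 ->
  #|[set tau | (#|patsupp tau| <= m)%N]%SET|%:R * t ^+ m <= (1 + t * #|T|%:R) ^+ n.
Proof.
move=> t0 t1.
pose F (x : option T) : R := if x is Some _ then t else 1.
have -> : (1 + t * #|T|%:R) ^+ n = \sum_(tau : {ffun 'I_n -> option T}) \prod_k F (tau k).
  rewrite -(bigA_distr_bigA (fun (_ : 'I_n) x => F x)) /= (eq_bigr (fun _ => 1 + t * #|T|%:R)).
    by rewrite prodr_const card_ord.
  move=> k _; rewrite (bigD1 None) //=; congr (1 + _).
  rewrite (eq_bigr (fun _ => t)); last by case.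
  by rewrite sumr_const cardC1 card_option mulr_natr.
rewrite mulr_natl -sumr_const.
rewrite [leRHS](bigID (fun tau => tau \in [set tau | (#|patsupp tau| <= m)%N]%SET)) /=.
apply: ler_wpDr.
  apply: sumr_ge0 => tau _; apply: prodr_ge0 => k _.
  by rewrite /F; case: (tau k) => // _; apply: ltW.
apply: ler_sum => tau; rewrite inE => taum.
rewrite (bigID (fun k => k \in patsupp tau)) /= [X in _ <= _ * X]big1 ?mulr1; last first.
  by move=> k; rewrite inE negbK => /eqP ->.
rewrite (eq_bigr (fun _ => t)); last by move=> k; rewrite inE; case: (tau k).
rewrite prodr_const; apply: ler_wiXn2l => //; exact: ltW.
Qed.

End sparse.

(** * A Sauer-Shelah argument for words over an ordered alphabet *)

Section shatter.
Context {n b : nat}.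
Local Notation fn := {ffun 'I_n -> 'I_b}.
Local Notation pat := {ffun 'I_n -> option 'I_b}.
Implicit Types (f g : fn) (F G : {set fn}) (tau : pat).
Local Open Scope nat_scope.

(** A gap of two leaves a level strictly between the values, which can serve as a threshold. *)
Definition far f g : {set 'I_n} :=
  [set k | (f k + 1 < g k) || (g k + 1 < f k)]%SET.

Definition realizes f tau (sigma : {ffun 'I_n -> bool}) : bool :=
  [forall k, if tau k is Some l then
    if sigma k then l < f k else f k < l else true].

Definition shattered F : {set pat} :=
  [set tau | [forall sigma, [exists f in F, realizes f tau sigma]]]%SET.

Lemma shatteredP F tau :
  reflect (forall sigma, exists2 f, f \in F & realizes f tau sigma)
    (tau \in shattered F).
Proof.
rewrite inE; apply: (iffP forallP) => H sigma.
  by have /exists_inP := H sigma.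
by apply/exists_inP.
Qed.

Definition slice F (k : 'I_n) (i : 'I_b) : {set fn} := [set f in F | f k == i]%SET.

Lemma shatteredS F G : F \subset G -> shattered F \subset shattered G.
Proof.
move=> /fintype.subsetP FG; apply/fintype.subsetP => tau /shatteredP H; apply/shatteredP => s.
by have [f fF ft] := H s; exists f => //; apply: FG.
Qed.

(** All members of the slice take the value [i] at [k], which cannot be both above and below one
    threshold. *)
Lemma shattered_slice_None F k i tau : tau \in shattered (slice F k i) ->
  tau k = None.
Proof.
move=> /shatteredP H; case E : (tau k) => [l|//].
have [f] := H [ffun=> true]; rewrite inE => /andP[_ /eqP fk] /forallP /(_ k).
rewrite E ffunE fk => li.
have [g] := H [ffun=> false]; rewrite inE => /andP[_ /eqP gk] /forallP /(_ k).
by rewrite E ffunE gk => /(ltn_trans li); rewrite ltnn.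
Qed.

(* A pattern shattered by both slices, neither of which involves [k], remains
   shattered by [F] after adding the threshold [i + 1] at [k]. *)
Lemma card_shattered_slices F k (i j : 'I_b) : i + 1 < j ->
  #|shattered (slice F k i)| + #|shattered (slice F k j)| <= #|shattered F|.
Proof.
move=> ij; have lb : i.+1 < b by rewrite -addn1; exact: ltn_trans ij (ltn_ord j).
pose l := Ordinal lb.
pose h (tau : pat) : pat := [ffun k' => if k' == k then Some l else tau k'].
set A := shattered (slice F k i); set A' := shattered (slice F k j).
have sliceS a : slice F k a \subset F by apply/fintype.subsetP => f; rewrite inE => /andP[].
have AF : A \subset shattered F by exact: shatteredS.
have AF' : A' \subset shattered F by exact: shatteredS.
have hinj : {in A :&: A' &, injective h}.
  move=> x y /finset.setIP[/shattered_slice_None xk _].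
  move=> /finset.setIP[/shattered_slice_None yk _] /ffunP hxy.
  apply/ffunP => k'; have := hxy k'; rewrite !ffunE; case: eqP => // -> _.
  by rewrite xk yk.
have hF : h @: (A :&: A') \subset shattered F.
  apply/fintype.subsetP => _ /imsetP[tau /finset.setIP[At At'] ->]; apply/shatteredP => s.
  have tk := shattered_slice_None At.
  move: At At' => /shatteredP/(_ s)[f fF fs] /shatteredP/(_ s)[g gF gs].
  move: fF gF; rewrite !inE => /andP[fF /eqP fk] /andP[gF /eqP gk].
  (* [j] lies above the threshold [i + 1] and [i] below it, so the sign at [k] tells which slice
     supplies the witness. *)
  case sk : (s k).
    exists g => //; apply/forallP => k'; rewrite ffunE; case: eqP => [->|_].
      by rewrite sk gk /= -addn1.
    exact: (forallP gs).
  exists f => //; apply/forallP => k'; rewrite ffunE; case: eqP => [->|_].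
    by rewrite sk fk /=.
  exact: (forallP fs).
(* Patterns shattered by both slices count twice; the second time they are replaced by their images
   under [h], which are new because they involve [k]. *)
rewrite -cardsUI -(card_in_imset hinj) -cardsUI.
have -> : (A :|: A') :&: [set h x | x in A :&: A']%SET = finset.set0.
  apply/finset.setP => x; rewrite [RHS]inE; apply/negP.
  move=> /finset.setIP[Ux /imsetP[tau _ xE]].
  have : x k = None by case/finset.setUP: Ux => /shattered_slice_None.
  by rewrite xE ffunE eqxx.
rewrite cards0 addn0; apply: subset_leq_card.
by rewrite !finset.subUset AF AF' hF.
Qed.

(* Otherwise every pair of values that are far at [k] contains a value taken by
   fewer than [C ^ m] members of [F], and there are too few such pairs. *)
Lemma heavy_slices F D C m : 0 < D -> 1 < C -> 4 * n * b <= C * D ->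
  {in F &, forall f g, f != g -> D <= #|far f g|} -> C ^ m.+1 <= #|F| ->
  exists k (i j : 'I_b), [/\ i + 1 < j, C ^ m <= #|slice F k i| &
    C ^ m <= #|slice F k j|].
Proof.
move=> D0 C1 CD Ffar CF; apply: contrapT => noheavy.
pose light (k : 'I_n) (i : 'I_b) := #|slice F k i| < C ^ m.
have farlight f g k : k \in far f g -> light k (f k) || light k (g k).
  move=> kfg; apply: contrapT => /negP; rewrite negb_or -!leqNgt => /andP[hf hg].
  apply: noheavy; move: kfg; rewrite inE => /orP[fg|gf].
    by exists k, (f k), (g k).
  by exists k, (g k), (f k).
have lightF k : \sum_(f in F) light k (f k) <= b * (C ^ m).-1.
  rewrite (partition_big (fun f : fn => f k) xpredT) //=.
  rewrite -[X in X * _](card_ord b) -sum_nat_const; apply: leq_sum => i _.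
  case: (boolP (light k i)) => li; last first.
    by rewrite big1 // => f /andP[_ /eqP ->]; rewrite (negbTE li).
  have Cm0 : 0 < C ^ m by rewrite expn_gt0 (ltn_trans _ C1).
  rewrite -ltnS (prednK Cm0); apply: leq_ltn_trans li.
  rewrite -sum1_card big_mkcond [leqRHS]big_mkcond; apply: leq_sum => f _.
  by rewrite inE; case: ifP => // _; exact: leq_b1.
set N := #|F| in CF *.
have N2 : 2 <= N.
  apply: leq_trans CF; rewrite expnS; apply: (leq_trans C1).
  by rewrite leq_pmulr // expn_gt0 (ltn_trans _ C1).
(* Count the triples [(f, g, k)] with [k] in [far f g] in two ways: from below by separation, from
   above by charging each triple to a light value of [f] or [g] at [k]. *)
have lower : N * (N.-1 * D) <= \sum_(f in F) \sum_(g in F) #|far f g|.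
  rewrite /N -sum_nat_const; apply: leq_sum => f fF.
  rewrite (cardsD1 f) fF add1n /= -sum_nat_const [leqRHS](bigD1 f) //=.
  apply: leq_trans (leq_addl _ _); rewrite [leqRHS](eq_bigl (mem (F :\ f)%SET)); last first.
    by move=> g; rewrite !inE andbC.
  by apply: leq_sum => g; rewrite !inE eq_sym => /andP[gf gF]; apply: Ffar.
have upper : \sum_(f in F) \sum_(g in F) #|far f g| <= n * (2 * N * (b * (C ^ m).-1)).
  apply: (@leq_trans (\sum_(f in F) \sum_(g in F)
      \sum_(k < n) (light k (f k) + light k (g k)))).
    apply: leq_sum => f _; apply: leq_sum => g _; rewrite -sum1_card big_mkcond /=.
    apply: leq_sum => k _; case: ifP => // /farlight.
    by case: (light k (f k)); case: (light k (g k)).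
  under eq_bigr do rewrite exchange_big /=.
  rewrite exchange_big /= -[X in X * _](card_ord n) -sum_nat_const.
  apply: leq_sum => k _.
  under eq_bigr do rewrite big_split /= sum_nat_const.
  rewrite big_split /= -big_distrr /= sum_nat_const -/N addnn -mul2n mulnA.
  by rewrite leq_mul2l lightF orbT.
(* With [K = C ^ m], the counts give [N.-1 * D <= 2 * n * b * K.-1]. As [N >= 2], [D * N] is at most
   twice the left side, which contradicts [4 * n * b * K <= D * N]. *)
have := leq_trans lower upper; have := CF; rewrite expnS.
have : 0 < C ^ m by rewrite expn_gt0 (ltn_trans _ C1).
move: (C ^ m) => K K0 CK LU.
have {}LU : N.-1 * D <= 2 * n * b * K.-1.
  rewrite -(leq_pmul2l (ltnW N2)); apply: leq_trans LU _; nia.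
have : 4 * n * b * K <= D * N.
  by rewrite (leq_trans (_ : _ <= C * D * K)) ?leq_mul2r ?CD ?orbT //; nia.
nia.
Qed.

(** Induction on [m]: the two heavy slices inherit the separation, and the numbers of patterns they
    shatter add up. *)
Lemma card_shattered F D C m : 0 < D -> 1 < C -> 4 * n * b <= C * D ->
  {in F &, forall f g, f != g -> D <= #|far f g|} -> C ^ m <= #|F| ->
  2 ^ m <= #|shattered F|.
Proof.
move=> D0 C1 CD; elim: m F => [|m IH] F Ffar CF.
  rewrite expn0 in CF *; case/card_gt0P: CF => f fF; apply/card_gt0P.
  exists [ffun=> None]; apply/shatteredP => s; exists f => //.
  by apply/forallP => k; rewrite ffunE.
have [k [i [j [ij ki kj]]]] := heavy_slices D0 C1 CD Ffar CF.
apply: leq_trans (card_shattered_slices F k ij).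
have sl a : {in slice F k a &, forall f g, f != g -> D <= #|far f g|}.
  by move=> f g; rewrite !inE => /andP[fF _] /andP[gF _]; apply: Ffar.
by rewrite expnS mul2n -addnn leq_add // IH.
Qed.

End shatter.

(** * Sparse patterns are few, so a large shattered set contains a pattern of large support *)

Section subexponential.
Context {R : realType}.

(** For [t] small against [c / b] the weighted count is at most [expR (c / 2 * n%:R)]; removing the
    weight [t ^+ d] costs at most the same factor when [d] is a small proportion of [n]. *)
Lemma sparse_patterns_subexponential (b : nat) (c : R) : 0 < c ->
  exists2 alpha : R, 0 < alpha & forall n d : nat, d%:R <= alpha * n%:R ->
    #|[set tau : {ffun 'I_n -> option 'I_b} | (#|patsupp tau| <= d)%N]%SET|%:R
      <= expR (c * n%:R).
Proof.
move=> c0; pose t := Num.min 1 (c / (2 * b.+1%:R)).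
have b0 : (0 : R) < b.+1%:R by rewrite ltr0n.
have t0 : 0 < t by rewrite lt_min ltr01 divr_gt0 // mulr_gt0.
have t1 : t <= 1 by rewrite ge_min lexx.
have tb : t * b%:R <= c / 2.
  have tle : t <= c / (2 * b.+1%:R) by rewrite ge_min lexx orbT.
  apply: (@le_trans _ _ (t * b.+1%:R)); first by rewrite ler_pM2l // ler_nat.
  by rewrite -ler_pdivlMr // -mulrA -invfM.
have lt0 : ln t <= 0 by rewrite ln_le0.
(* The denominator has [1 - ln t] because [ln t] vanishes when [t = 1]. *)
exists (c / (2 * (1 - ln t))).
  by rewrite divr_gt0 // mulr_gt0 // subr_gt0 (le_lt_trans lt0).
move=> n d dn.
have := @card_sparse_patterns R n 'I_b t d t0 t1; rewrite card_ord.
set N := #|_|%:R => NH.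
have {}NH : N * t ^+ d <= expR (c / 2 * n%:R).
  apply: (le_trans NH); rewrite expRM_natr lerXn2r ?nnegrE ?expR_ge0 //.
    by rewrite addr_ge0 // mulr_ge0 // ltW.
  by apply: le_trans (expR_ge1Dx _) _; rewrite ler_expR.
have -> : N = (N * t ^+ d) * (t ^- d) by rewrite mulfK // expf_neq0 // gt_eqF.
have -> : expR (c * n%:R) = expR (c / 2 * n%:R) * expR (c / 2 * n%:R).
  by rewrite -expRD; congr expR; field.
apply: ler_pM => //.
- by rewrite mulr_ge0 // ?exprn_ge0 // ltW.
- by rewrite invr_ge0 exprn_ge0 // ltW.
have -> : t ^- d = expR (- ln t * d%:R).
  by rewrite expRM_natr expRN lnK ?posrE // exprVn.
rewrite ler_expR; apply: (@le_trans _ _ (- ln t * (c / (2 * (1 - ln t)) * n%:R))).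
  by rewrite ler_wpM2l // oppr_ge0.
rewrite mulrA ler_wpM2r //.
have h : 0 < 1 - ln t by rewrite subr_gt0 (le_lt_trans lt0).
have -> : - ln t * (c / (2 * (1 - ln t))) = (c / 2) * (- ln t / (1 - ln t)).
  by field; rewrite gt_eqF.
by rewrite ler_piMr ?divr_ge0 ?(ltW c0) // ler_pdivrMr // mul1r; lra.
Qed.

(** [card_shattered] yields exponentially many shattered patterns, more than there are patterns of
    support below [alpha * n%:R]. *)
Lemma separated_shatter (b : nat) (c delta : R) : 0 < c -> 0 < delta ->
  exists2 alpha : R, 0 < alpha & \forall n \near \oo,
    forall F : {set {ffun 'I_n -> 'I_b}},
      {in F &, forall f g, f != g -> delta * n%:R <= #|far f g|%:R} ->
      expR (c * n%:R) < #|F|%:R ->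
      exists2 tau, tau \in shattered F & alpha * n%:R <= #|patsupp tau|%:R.
Proof.
move=> c0 d0.
(* Chosen so that [4 * n * b <= C * D] for the integer part [D] of [delta * n%:R], which is at least
   half of it for large [n]. *)
pose C := (Num.truncn (8 * b%:R / delta)).+2.
have C1 : (1 < C)%N by [].
have Cd : 8 * b%:R <= C%:R * delta.
  rewrite -ler_pdivrMr //; apply: ltW; apply: (lt_trans (truncnS_gt _)).
  by rewrite ltr_nat.
have lnC : 0 < ln C%:R :> R by rewrite ln_gt0 // ltr1n.
have ln2 : 0 < ln 2 :> R by rewrite ln_gt0 // ltr1n.
(* Below, [m] is at least half of [c * n%:R / ln C%:R], so that [2 ^ m] is at least
   [expR (2 * c1 * n%:R)]. *)
pose c1 : R := ln 2 * c / (4 * ln C%:R).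
have c10 : 0 < c1 by rewrite divr_gt0 ?mulr_gt0.
have [alpha a0 sparse] := sparse_patterns_subexponential b c10.
exists alpha => //; near=> n => F Fsep cF.
have dn1 : 1 <= delta * n%:R by rewrite -ler_pdivrMl // mulr1; near: n; exact: nbhs_infty_ger.
have cn1 : ln C%:R / c <= n%:R by near: n; exact: nbhs_infty_ger.
have n0 : (0 : R) < n%:R.
  by apply: lt_le_trans cn1; rewrite divr_gt0.
pose D := Num.truncn (delta * n%:R).
have D0 : (0 < D)%N by rewrite truncn_gt0.
have dD : delta * n%:R <= 2 * D%:R.
  have := truncnS_gt (delta * n%:R); rewrite -/D -natr1.
  have : 1 <= D%:R :> R by rewrite ler1n.
  by lra.
have CD : (4 * n * b <= C * D)%N.
  rewrite -(ler_nat R) !natrM.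
  have : 8 * b%:R * n%:R <= C%:R * delta * n%:R by rewrite ler_pM2r.
  have : C%:R * (delta * n%:R) <= C%:R * (2 * D%:R) :> R by rewrite ler_wpM2l.
  by nra.
pose m := Num.truncn (c * n%:R / ln C%:R).
have cm : c * n%:R / ln C%:R <= 2 * m%:R.
  have := truncnS_gt (c * n%:R / ln C%:R); rewrite -/m -natr1.
  have : 1 <= m%:R :> R by rewrite ler1n truncn_gt0 ler_pdivlMr // mul1r mulrC -ler_pdivrMr.
  by lra.
have CF : (C ^ m <= #|F|)%N.
  rewrite -(ler_nat R); apply: (le_trans _ (ltW cF)).
  rewrite natrX -[X in X ^+ _]lnK ?posrE ?ltr0n // -expRM_natr ler_expR mulrC.
  by rewrite -ler_pdivlMr // truncn_le // divr_ge0 ?mulr_ge0 // ltW.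
have Fsep' : {in F &, forall f g, f != g -> (D <= #|far f g|)%N}.
  move=> f g fF gF fg; rewrite -(ler_nat R); apply: le_trans (Fsep f g fF gF fg).
  by rewrite truncn_le // mulr_ge0 // ltW.
have := card_shattered D0 C1 CD Fsep' CF.
apply: contraPP => noshat; apply/negP; rewrite -ltnNge -(ltr_nat R) natrX.
apply: (@le_lt_trans _ _ (expR (c1 * n%:R))).
  apply: le_trans (sparse n (Num.truncn (alpha * n%:R)) _); last first.
    by rewrite truncn_le // mulr_ge0 // ltW.
  rewrite ler_nat; apply/subset_leq_card/fintype.subsetP => tau Ft; rewrite inE.
  rewrite truncn_ge_nat ?mulr_ge0 ?(ltW a0) // leNgt; apply/negP => /ltW at'.
  by apply: noshat; exists tau.
rewrite -[X in X ^+ _]lnK ?posrE // -expRM_natr ltr_expR.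
have : ln 2 * (c * n%:R / ln C%:R) <= ln 2 * (2 * m%:R) by rewrite ler_pM2l.
have -> : ln 2 * (c * n%:R / ln C%:R) = 4 * (c1 * n%:R) by rewrite /c1; field; rewrite gt_eqF.
have : 0 < c1 * n%:R by rewrite mulr_gt0.
by nra.
Unshelve. all: by end_near. Qed.

End subexponential.

(** * Covering numbers *)

Section covering.
Context {R : realType}.
Implicit Types (U : set (nat -> R)) (u v : nat -> R) (p : \bar R).

Lemma seq_dist_lt n p u v (r : R) : (1 <= p)%E -> 0 < r ->
  (forall k, (k < n)%N -> `|u k - v k| < r) -> seq_dist n p u v < r.
Proof.
move=> p1 r0 uv.
have big : \big[Num.max/0]_(k < n) `|u k - v k| < r.
  by elim/big_ind : _ => // [x y xr yr|k _]; [rewrite gt_max xr yr|exact: uv].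
case: p p1 => [q| |] //= q1; rewrite lee_fin in q1.
have q0 : 0 < q by exact: lt_le_trans q1.
case: n uv {big} => [|n] uv.
  by rewrite big_ord0 mulr0 powR0 // invr_neq0 // gt_eqF.
have -> : r = (r `^ q) `^ q^-1 by rewrite -powRrM mulfV ?gt_eqF // powRr1 // ltW.
have n0 : 0 < n.+1%:R :> R by rewrite ltr0n.
apply: gt0_ltr_powR; rewrite ?invr_gt0 //.
- by rewrite nnegrE mulr_ge0 ?invr_ge0 // sumr_ge0 // => k _; exact: powR_ge0.
- by rewrite nnegrE powR_ge0.
rewrite ltr_pdivrMl // mulr_natl -[n.+1 in ltRHS]card_ord -sumr_const.
apply: ltr_sum => [|k _]; first by apply/hasP; exists ord0; rewrite // mem_index_enum.
by apply: gt0_ltr_powR; rewrite ?nnegrE // ?(ltW r0) //; apply: uv.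
Qed.

Lemma covering_number_le_card U r n p (I : finType) (A : {set I}) (c : I -> nat -> R) :
  (forall u, U u -> exists2 i, i \in A & seq_dist n p (c i) u < r) ->
  (covering_number U r n p <= #|A|%:R%:E)%E.
Proof.
move=> Uc; apply: ereal_inf_lbound; exists #|A| => //.
exists (fun i => c (enum_val i)) => u /Uc [i iA ui].
by exists (enum_rank_in iA i) => //=; rewrite enum_rankK_in.
Qed.

Section level.
Variables (B eta : R).
Hypothesis eta0 : 0 < eta.

Definition level_count : nat := Num.truncn (2 * B / eta).

(** The default value of [inord] never occurs when [u] is bounded by [B]. *)
Definition level n u : {ffun 'I_n -> 'I_level_count.+1} :=
  [ffun k : 'I_n => inord (Num.truncn ((u k + B) / eta))].

Lemma levelP n u (k : 'I_n) : `|u k| <= B ->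
  eta * (level n u k)%:R <= u k + B < eta * (level n u k).+1%:R.
Proof.
rewrite ler_norml => /andP[Bu uB].
have u0 : 0 <= (u k + B) / eta by rewrite divr_ge0 ?(ltW eta0) //; lra.
rewrite ffunE inordK; last first.
  rewrite ltnS; apply: le_truncn; rewrite ler_pM2r ?invr_gt0 //; lra.
have /andP[h1 h2] := truncn_itv u0.
by rewrite mulrC -ler_pdivlMr // h1 /= mulrC -ltr_pdivrMr.
Qed.

End level.

Lemma covering_or_shattering (B eta c : R) : 0 < eta -> 0 < c ->
  exists2 alpha : R, 0 < alpha & \forall n \near \oo,
    forall U p, (1 <= p)%E -> (forall u k, U u -> `|u k| <= B) ->
    (covering_number U (2 * eta) n p <= (expR (c * n%:R))%:E)%E \/
    exists2 tau : {ffun 'I_n -> option 'I_(level_count B eta).+1},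
      alpha * n%:R <= #|patsupp tau|%:R &
      forall sigma, exists2 u, U u & realizes (level B eta n u) tau sigma.
Proof.
move=> eta0 c0; set b := (level_count B eta).+1.
(* Half of the exponent pays for the choice of a member of [F], the other half for its sparse
   correction. *)
have c2 : 0 < c / 2 by rewrite divr_gt0.
have [delta d0 sparse] := sparse_patterns_subexponential b c2.
have [alpha a0 shat] := separated_shatter b c2 d0.
exists alpha => //; apply: filterS shat => n shat U p p1 UB.
pose im : {set {ffun 'I_n -> 'I_b}} :=
  [set f | `[< exists2 u, U u & level B eta n u = f >]]%SET.
pose sep (F : {set {ffun 'I_n -> 'I_b}}) := (F \subset im) &&
  [forall f in F, [forall g in F, (f != g) ==> (delta * n%:R <= #|far f g|%:R)]].
have sep0 : sep finset.set0.
  by rewrite /sep finset.sub0set; apply/forall_inP => f; rewrite inE.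
have [F /maxsetP[/andP[Fim /forall_inP Fsep] Fmax] _] := maxset_exists sep0.
have [cF|cF] := lerP #|F|%:R (expR (c / 2 * n%:R)); last first.
  right; have [||tau] := shat F => //.
    by move=> f g fF gF fg; have /forall_inP/(_ g gF)/implyP/(_ fg) := Fsep f fF.
  move=> /shatteredP Ftau atau; exists tau => // sigma.
  have [f fF fs] := Ftau sigma.
  have := fintype.subsetP Fim f fF; rewrite inE => /asboolP[u Uu uf].
  by exists u; rewrite // uf.
left.
pose d := Num.truncn (delta * n%:R).
have dd : d%:R <= delta * n%:R by rewrite truncn_le // mulr_ge0 // ltW.
pose Sp := [set tau : {ffun 'I_n -> option 'I_b} | (#|patsupp tau| <= d)%N]%SET.
(* The centers are the members of [F], corrected at a sparse set of coordinates. *)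
pose cen (x : {ffun 'I_n -> 'I_b} * {ffun 'I_n -> option 'I_b}) (k : nat) : R :=
  if insub k is Some i then eta * (odflt (x.1 i) (x.2 i))%:R - B else 0.
apply: (@le_trans _ _ (#|finset.setX F Sp|%:R%:E)); last first.
  rewrite lee_fin cardsX natrM.
  have -> : c * n%:R = c / 2 * n%:R + c / 2 * n%:R by field.
  by rewrite expRD ler_pM // sparse.
apply: (@covering_number_le_card _ _ _ _ _ _ cen) => u Uu.
set f := level B eta n u.
have fim : f \in im by rewrite inE; apply/asboolP; exists u.
(* By maximality: if [f] were far from every member, adding it would keep [F] separated, so [f]
   would belong to [F]; but [f] is not far from itself. *)
have [g gF gf] : exists2 g, g \in F & (#|far g f| <= d)%N.
  apply: contrapT => nog.
  have far_fF g : g \in F -> delta * n%:R <= #|far g f|%:R.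
    move=> gF; rewrite leNgt; apply/negP => /ltW lt; apply: nog; exists g => //.
    by rewrite truncn_ge_nat // mulr_ge0 // ltW.
  have farC (g h : {ffun 'I_n -> 'I_b}) : far g h = far h g.
    by apply/finset.setP => k; rewrite !inE orbC.
  have : sep (f |: F)%SET.
    rewrite /sep finset.subUset finset.sub1set fim Fim /=.
    apply/forall_inP => g /setU1P[->|gF]; apply/forall_inP => h /setU1P[->|hF].
    - by rewrite eqxx.
    - by apply/implyP => _; rewrite farC far_fF.
    - by apply/implyP => _; exact: far_fF.
    - by have /forall_inP/(_ h hF) := Fsep g gF.
  move=> /Fmax /(_ (finset.subsetUr _ _)) fF.
  apply: nog; exists f; first by rewrite -fF setU11.
  rewrite (_ : far f f = finset.set0) ?cards0 //.
  by apply/finset.setP => k; rewrite !inE addn1 ltnNge leqnSn.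
exists (g, [ffun k => if k \in far g f then Some (f k) else None]).
  rewrite inE /= gF inE; apply: leq_trans gf; apply/subset_leq_card/fintype.subsetP => k.
  by rewrite !inE ffunE inE; case: ifP.
apply: seq_dist_lt => // [|k kn]; first by rewrite mulr_gt0.
rewrite /cen; case: insubP => [i _ ik|]; last by rewrite kn.
have /andP[] := @levelP B eta eta0 n u i (UB _ _ Uu); rewrite -/f -[(f i).+1%:R]natr1.
rewrite ik [X in odflt _ X]ffunE ltr_norml; case: ifP => /= [_|]; first by nra.
(* At an uncorrected coordinate the levels of [u] and [g] differ by at most one, and rounding adds
   less than [eta]: hence the radius [2 * eta]. *)
rewrite inE => /negbT; rewrite negb_or -!leqNgt !addn1.
rewrite -!(ler_nat R) -!natr1 => /andP[h1 h2].
have := ler_wpM2l (ltW eta0) h1; have := ler_wpM2l (ltW eta0) h2.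
by nra.
Qed.

End covering.

(** * Integration and independence *)

Section real_integration.
Context {d : measure_display} {Omega : measurableType d} {R : realType}.
Context {P : probability Omega R}.
Implicit Types (f g : Omega -> R).
Local Notation itg f := (P.-integrable [set: Omega] (EFin \o f)).

Lemma itg_ext f g : f =1 g -> itg f -> itg g.
Proof. by move=> fg; rewrite (funext fg). Qed.

Lemma itg_cst r : itg (fun=> r).
Proof. exact: finite_measure_integrable_cst. Qed.

Lemma itgD f g : itg f -> itg g -> itg (fun w => f w + g w).
Proof. by move=> fi gi; exact: (integrableD measurableT fi gi). Qed.

Lemma itgZ r f : itg f -> itg (fun w => r * f w).
Proof. by move=> fi; have := integrableZl measurableT r fi. Qed.

Lemma itgB f g : itg f -> itg g -> itg (fun w => f w - g w).
Proof.
by move=> fi gi; apply: itg_ext (itgD fi (itgZ (-1) gi)) => w /=; rewrite mulN1r.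
Qed.

Lemma itg_norm f : itg f -> itg (fun w => `|f w|).
Proof. by move=> fi; have := integrable_norm fi. Qed.

Lemma itg_sum (I : Type) (s : seq I) (Q : pred I) (F : I -> Omega -> R) :
  (forall i, Q i -> itg (F i)) -> itg (fun w => \sum_(i <- s | Q i) F i w).
Proof.
move=> Fi; have := integrable_sum measurableT s Fi.
by apply: eq_integrable => // w _ /=; rewrite sumEFin.
Qed.

Lemma itg_le f g : measurable_fun [set: Omega] f -> (forall w, `|f w| <= g w) ->
  itg g -> itg f.
Proof.
move=> mf fg; apply: le_integrable => //; first exact/measurable_EFinP.
by move=> w _ /=; rewrite lee_fin (le_trans (fg w)) // ler_norm.
Qed.

Lemma measurable_of_itg f : itg f -> measurable_fun [set: Omega] f.
Proof. by move=> /integrableP[/measurable_EFinP]. Qed.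

Lemma Rintegral_setT_cst r : \int[P]_w r = r.
Proof.
rewrite Rintegral_cst // -[RHS]mulr1; congr (_ * _).
exact: (congr1 fine (probability_setT P)).
Qed.

Lemma Rintegral_sum (I : Type) (s : seq I) (Q : pred I) (F : I -> Omega -> R) :
  (forall i, Q i -> itg (F i)) ->
  \int[P]_w (\sum_(i <- s | Q i) F i w) = \sum_(i <- s | Q i) \int[P]_w F i w.
Proof.
move=> Fi; elim: s => [|i s IH].
  by under eq_Rintegral do rewrite big_nil; rewrite Rintegral_setT_cst big_nil.
under eq_Rintegral do rewrite big_cons; rewrite big_cons.
case: ifP => // Qi; rewrite RintegralD //; [by rewrite IH|exact: Fi|exact: itg_sum].
Qed.

Lemma itg_indic_mul (E : set Omega) f : measurable E -> itg f ->
  itg (fun w => \1_E w * f w).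
Proof.
move=> mE fi; apply: itg_le (itg_norm fi).
  by apply: measurable_funM; [exact: measurable_indic|exact: measurable_of_itg].
by move=> w; rewrite normrM ler_piMl // indicE; case: (w \in E); rewrite ?normr0 ?normr1.
Qed.

Lemma itg_indic (E : set Omega) : measurable E -> itg (\1_E : Omega -> R).
Proof. by move=> mE; apply: itg_ext (itg_indic_mul mE (itg_cst 1)) => w; rewrite mulr1. Qed.

Lemma Rintegral_indic (E : set Omega) : measurable E ->
  \int[P]_w (\1_E w) = fine (P E).
Proof. by move=> mE; rewrite /Rintegral integral_indic // setIT. Qed.

Section finite_valued.
Variables (J : finType) (Z : Omega -> J).
Hypothesis mZ : forall j, measurable (Z @^-1` [set j]).

(** [F] keeps its own dependence on [w], to allow a coefficient selected by [Z w] times the noise at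
    [w]. *)
Lemma fin_valuedE (F : J -> Omega -> R) w :
  F (Z w) w = \sum_j \1_(Z @^-1` [set j]) w * F j w.
Proof.
rewrite (bigD1 (Z w)) //= big1 ?addr0; last first.
  by move=> j jZ; rewrite indicE memNset ?mul0r // => /= jE; rewrite jE eqxx in jZ.
by rewrite indicE mem_set ?mul1r.
Qed.

Lemma itg_fin_valued (F : J -> Omega -> R) : (forall j, itg (F j)) ->
  itg (fun w => F (Z w) w).
Proof.
move=> Fi; apply: itg_ext (fun w => esym (fin_valuedE F w)) _.
by apply: itg_sum => j _; apply: itg_indic_mul.
Qed.

Lemma Rintegral_fin_valued (F : J -> Omega -> R) : (forall j, itg (F j)) ->
  \int[P]_w F (Z w) w = \sum_j \int[P]_w (\1_(Z @^-1` [set j]) w * F j w).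
Proof.
move=> Fi; under eq_Rintegral do rewrite fin_valuedE.
by rewrite Rintegral_sum // => j _; apply: itg_indic_mul.
Qed.

Lemma Rintegral_fin_valued_cst (F : J -> R) :
  \int[P]_w F (Z w) = \sum_j fine (P (Z @^-1` [set j])) * F j.
Proof.
rewrite (Rintegral_fin_valued (fun j => itg_cst (F j))).
apply: eq_bigr => j _; rewrite RintegralZr //; last exact: itg_indic.
by rewrite Rintegral_indic.
Qed.

End finite_valued.

Import HBSimple.

(** Simple functions approximate the identity in L1 of the law of [X]. Working on the law makes the
    approximant a function of [X], so composing with it preserves independence. *)
Lemma simple_approximation (X : {RV P >-> R}) (eta : R) : itg X -> 0 < eta ->
  exists (J : finType) (a : J -> R) (idx : R -> J),
    (forall j, measurable (idx @^-1` [set j])) /\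
    \int[P]_w `|X w - a (idx (X w))| <= eta.
Proof.
move=> Xi eta0.
have idi : (distribution P X).-integrable [set: R] EFin.
  by apply: integrable_pushforward => //; rewrite preimage_setT.
have [g [gi _ gl1]] := approximation_sfun_integrable measurableT idi.
have [n gn] : exists n, (\int[distribution P X]_x `|x%:E - (g n x)%:E| < eta%:E)%E.
  have eta0' : (0 < eta%:E)%E by rewrite lte_fin.
  by have [n _ H] := gl1 _ (open_ereal_lt' eta0'); exists n; apply: H => /=.
have frange : finite_set (range (g n)) by exact: fimfunP.
pose K := fset_set (range (g n)).
have inK x : g n x \in K by rewrite in_fset_set // inE; exists x.
exists K, (fun j => val j), (fun x => [` inK x]%fset); split.
  move=> j; rewrite (_ : _ @^-1` _ = g n @^-1` [set val j]); last first.
    by apply/seteqP; split => x /=; [move=> <-|move=> xj; apply: val_inj].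
  by rewrite -[_ @^-1` _]setTI; exact: measurable_funP.
rewrite -lee_fin /Rintegral fineK; last first.
  apply: integrable_fin_num => //.
  have H : itg (fun w => g n (X w)).
    have : (EFin \o g n) \o X = EFin \o (fun w => g n (X w)) by [].
    move=> <-; have /integrableP[mgn _] := gi n.
    apply/integrableP; split; first exact: measurableT_comp.
    have /integrableP[_] := gi n; rewrite ge0_integral_distribution //.
    by apply: measurableT_comp.
  exact: itg_norm (itgB Xi H).
apply: ltW; apply: le_lt_trans gn; rewrite ge0_integral_distribution //.
by apply: measurableT_comp => //; apply: emeasurable_funB => //; have /integrableP[] := gi n.
Qed.

End real_integration.

Section independence.
Context {d : measure_display} {Omega : measurableType d} {R : realType}.
Context {P : probability Omega R} (eps : nat -> {RV P >-> R}).
Hypothesis eps_indep : mutually_independent eps.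
Local Notation itg f := (P.-integrable [set: Omega] (EFin \o f)).

Lemma measurable_preimage_RV k (A : set R) : measurable A -> measurable (eps k @^-1` A).
Proof. by move=> mA; rewrite -[_ @^-1` _]setTI; exact: measurable_funP. Qed.

Lemma measurable_box n (A : 'I_n -> set R) : (forall k, measurable (A k)) ->
  measurable [set w | forall k, A k (eps k w)].
Proof.
move=> mA; rewrite (_ : [set w | _] = \bigcap_(k in [set: 'I_n]) (eps k @^-1` A k)).
  by apply: fin_bigcap_measurable => // k _; exact: measurable_preimage_RV.
by apply/seteqP; split => [w H k _|w H k]; exact: H.
Qed.

Lemma independent_box n (A : 'I_n -> set R) : (forall k, measurable (A k)) ->
  fine (P [set w | forall k, A k (eps k w)]) = \prod_(k < n) fine (P (eps k @^-1` A k)).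
Proof.
(* Independence is stated for sets indexed by [nat], so the box is extended by [setT]. *)
move=> mA; pose A' (k : nat) := if insub k is Some i then A i else setT.
have A'E (i : 'I_n) : A' i = A i by rewrite /A' valK.
have mA' k : measurable (A' k) by rewrite /A'; case: insub.
pose J := [fset k in iota 0 n]%fset.
have := eps_indep J mA'.
rewrite (perm_big (iota 0 n)) /=; last first.
  by apply: uniq_perm; [exact: fset_uniq|exact: iota_uniq|] => k; rewrite in_fset.
have -> : iota 0 n = index_iota 0 n by rewrite /index_iota subn0.
rewrite big_mkord.
rewrite (_ : bigcap _ _ = [set w | forall k : 'I_n, A k (eps k w)]); last first.
  apply/seteqP; split => w H k.
    by rewrite -A'E; apply: H => /=; rewrite in_fset mem_iota /= add0n.
  rewrite /= in_fset mem_iota add0n => /andP[_ kn].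
  by have := H (Ordinal kn); rewrite -A'E.
move=> ->; rewrite (eq_bigr (fun k : 'I_n => (fine (P (eps k @^-1` A k)))%:E)).
  by rewrite prodEFin.
move=> k _; rewrite A'E fineK //; apply: fin_num_measure; exact: measurable_preimage_RV.
Qed.

(** The event leaves coordinate [k] free or is empty, so it is independent of [eps k]. The product
    formula holds for functions of [eps k] with finitely many values and passes to [eps k] by L1
    approximation. *)
Lemma Rintegral_indep_event n (A : 'I_n -> set R) (k : 'I_n) :
  (forall j, measurable (A j)) -> A k = setT \/ A k = set0 -> itg (eps k) ->
  \int[P]_w (\1_[set w | forall j, A j (eps j w)] w * eps k w) =
  fine (P [set w | forall j, A j (eps j w)]) * \int[P]_w eps k w.
Proof.
move=> mA Ak epsi; set E := [set w | _].
have mE : measurable E := measurable_box mA.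
have indE (C : set R) : measurable C ->
    fine (P (E `&` eps k @^-1` C)) = fine (P E) * fine (P (eps k @^-1` C)).
  (* The intersection is again a box, with [C] imposed at coordinate [k]. *)
  move=> mC; pose A' j := if j == k then A k `&` C else A j.
  have mA' j : measurable (A' j) by rewrite /A'; case: ifP => // _; exact: measurableI.
  rewrite (_ : E `&` _ = [set w | forall j, A' j (eps j w)]); last first.
    apply/seteqP; split => w /=.
      by move=> [Ew Cw] j; rewrite /A'; case: eqP => [->|_]; [split; [exact: Ew|]|exact: Ew].
    move=> H; split; last by have := H k; rewrite /A' eqxx => -[].
    by move=> j; have := H j; rewrite /A'; case: eqP => [->[]|].
  rewrite !independent_box // (bigD1 k) //= [in RHS](bigD1 k) //=.
  rewrite (eq_bigr (fun j : 'I_n => fine (P (eps j @^-1` A j)))); last first.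
    by move=> j /negbTE jk; rewrite /A' jk.
  rewrite /A' eqxx; case: Ak => ->; last by rewrite set0I preimage_set0 measure0 !mul0r.
  rewrite setTI preimage_setT.
  have -> : fine (P setT) = 1 by exact: (congr1 fine (probability_setT P)).
  by rewrite mul1r mulrC.
(* Replacing [eps k] by its approximant changes each side by at most [e / 2]. *)
apply/eqP; rewrite -subr_eq0 -normr_le0.
apply/ler_addgt0Pr => e e0; rewrite add0r.
have e2 : 0 < e / 2 by rewrite divr_gt0.
have [J [a [idx [midx approx]]]] := simple_approximation epsi e2.
pose Z w := idx (eps k w).
have mZ j : measurable (Z @^-1` [set j]) := measurable_preimage_RV k (midx j).
have Yi : itg (fun w => a (Z w)).
  by apply: (itg_fin_valued mZ (F := fun j _ => a j)) => j; exact: itg_cst.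
have YE : \int[P]_w (\1_E w * a (Z w)) = fine (P E) * \int[P]_w a (Z w).
  rewrite (Rintegral_fin_valued_cst mZ) mulr_sumr.
  rewrite (Rintegral_fin_valued mZ (F := fun j w => \1_E w * a j)); last first.
    by move=> j; apply: itg_indic_mul => //; exact: itg_cst.
  apply: eq_bigr => j _; under eq_Rintegral do rewrite mulrA.
  rewrite RintegralZr //; last first.
    by apply: (itg_indic_mul (mZ j)); exact: itg_indic.
  rewrite mulrA -(indE _ (midx j)) -Rintegral_indic; last exact: (measurableI _ _ mE (mZ j)).
  by congr (_ * a j); apply: eq_Rintegral => w _; rewrite mulrC indicI.
rewrite -[X in X - _](subrK (\int[P]_w (\1_E w * a (Z w)))) -addrA {2}YE -mulrBr.
rewrite -!RintegralB //; [|exact: itg_indic_mul..].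
have Di : itg (fun w => `|eps k w - a (Z w)|) by apply: itg_norm; exact: itgB.
apply: le_trans (ler_normD _ _) _; rewrite [leRHS](Num.Theory.splitr e); apply: lerD.
  apply: le_trans approx; apply: le_trans (le_normr_Rintegral _ _) _ => //.
    by apply: itgB; apply: itg_indic_mul.
  apply: le_Rintegral => //.
    by apply: itg_norm; apply: itgB; apply: itg_indic_mul.
  move=> w _; rewrite -mulrBr normrM ler_piMl // indicE.
  by case: (w \in E); rewrite ?normr0 ?normr1.
have approx' : \int[P]_w `|a (Z w) - eps k w| <= e / 2.
  by apply: le_trans approx; under eq_Rintegral do rewrite distrC.
rewrite normrM; apply: le_trans approx'; rewrite -[leRHS]mul1r.
apply: ler_pM => //.
  rewrite ger0_norm ?fine_ge0 // -lee_fin fineK ?fin_num_measure //; exact: probability_le1.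
exact: le_normr_Rintegral (itgB Yi epsi).

Qed.

End independence.

(** * Supremum of the process over a bounded set of sequences *)

Section process_sup.
Context {d : measure_display} {Omega : measurableType d} {R : realType}.
Context {P : probability Omega R} (eps : nat -> {RV P >-> R}).
Context (U : set (nat -> R)) (B : R).
Implicit Types (u : nat -> R).
Hypothesis U0 : U !=set0.
Hypothesis UB : forall u k, U u -> `|u k| <= B.
Local Notation itg f := (P.-integrable [set: Omega] (EFin \o f)).

Definition process_sup n (w : Omega) : R :=
  sup [set s | exists2 u, U u & s = \sum_(k < n) u k * eps k w].

Lemma process_le_norm u n w : U u ->
  `|\sum_(k < n) u k * eps k w| <= B * \sum_(k < n) `|eps k w|.
Proof.
move=> Uu; apply: le_trans (ler_norm_sum _ _ _) _; rewrite mulr_sumr.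
by apply: ler_sum => k _; rewrite normrM ler_wpM2r // UB.
Qed.

Lemma process_sup_ge u n w : U u -> \sum_(k < n) u k * eps k w <= process_sup n w.
Proof.
move=> Uu; apply: ub_le_sup; last by exists u.
exists (B * \sum_(k < n) `|eps k w|) => _ [v Uv ->].
by apply: le_trans (process_le_norm n w Uv); exact: ler_norm.
Qed.

Lemma process_sup_le n w M :
  (forall u, U u -> \sum_(k < n) u k * eps k w <= M) -> process_sup n w <= M.
Proof.
move=> UM; apply: ge_sup; last by move=> _ [u Uu ->]; exact: UM.
by have [u Uu] := U0; exists (\sum_(k < n) u k * eps k w), u.
Qed.

Lemma process_sup_norm n w : `|process_sup n w| <= B * \sum_(k < n) `|eps k w|.
Proof.
rewrite ler_norml; apply/andP; split; last first.
  apply: process_sup_le => u Uu.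
  by apply: le_trans (process_le_norm n w Uu); exact: ler_norm.
have [u Uu] := U0; apply: le_trans (process_sup_ge n w Uu).
by rewrite lerNl; apply: le_trans (process_le_norm n w Uu); rewrite -normrN ler_norm.
Qed.

Lemma measurable_process u n :
  measurable_fun [set: Omega] (fun w => \sum_(k < n) u k * eps k w).
Proof. by apply: measurable_sum => k; apply: measurable_funM. Qed.

(* The supremum over [U] is the supremum over a countable set of representatives,
   one for each value of the first [n] coordinates rounded to a multiple of
   [1 / m.+1]. *)
Lemma measurable_process_sup n : measurable_fun [set: Omega] (process_sup n).
Proof.
have [u0 Uu0] := U0.
pose code m (u : nat -> R) := [seq Num.truncn ((u k + B) * m.+1%:R) | k <- iota 0 n].
pose rep (c : nat * seq nat) : nat -> R := xget u0 [set u | U u /\ code c.1 u = c.2].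
have Urep c : U (rep c) by rewrite /rep; case: xgetP => // u _ [].
have code_near m u v k : U u -> U v -> code m u = code m v -> (k < n)%N ->
    `|u k - v k| <= m.+1%:R^-1.
  move=> Uu Uv cuv kn; have m0 : 0 < m.+1%:R :> R by rewrite ltr0n.
  have H x : U x -> 0 <= (x k + B) * m.+1%:R.
    move=> Ux; have := UB k Ux; rewrite ler_norml => /andP[? _].
    by rewrite mulr_ge0 ?(ltW m0) //; lra.
  have /(congr1 (fun s => nth 0%N s k)) := cuv.
  rewrite !(nth_map 0%N) ?size_iota // nth_iota // add0n => tE.
  have := truncn_itv (H _ Uu); have := truncn_itv (H _ Uv); rewrite tE.
  set t := Num.truncn _; rewrite -[t.+1%:R]natr1 => /andP[h1 h2] /andP[h3 h4].
  by rewrite -(ler_pM2r m0) mulVf ?gt_eqF // -[X in _ * X]gtr0_norm // -normrM ler_norml; lra.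
(* Integers that encode nothing get a default code; this is harmless since [rep] always takes values
   in [U]. *)
pose dec (i : nat) := odflt (0%N, [::]) (@choice.unpickle (nat * seq nat)%type i).
pose h (i : nat) w := \sum_(k < n) rep (dec i) k * eps k w.
have hub w : has_ubound (range (h ^~ w)).
  by exists (process_sup n w) => _ [i _ <-]; exact: process_sup_ge.
suff -> : process_sup n = fun w => sups (h ^~ w) 0%N.
  by apply: measurable_fun_sups => [w _|i]; [exact: hub|exact: measurable_process].
apply/funext => w; apply/eqP; rewrite eq_le; apply/andP; split; last first.
  apply: ge_sup; first by exists (h 0%N w), 0%N.
  by move=> _ [i _ <-]; exact: process_sup_ge.
apply: process_sup_le => u Uu; apply/ler_addgt0Pr => e e0.
set s := \sum_(k < n) `|eps k w|.
have s0 : 0 <= s by exact: sumr_ge0.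
(* Fine enough for the rounding to change the sum at [w] by at most [e]. *)
pose m := Num.truncn (s / e).
have me : m.+1%:R^-1 * s <= e.
  by rewrite ler_pdivrMl ?ltr0n // mulrC -ler_pdivrMl // mulrC ltW // truncnS_gt.
pose c := (m, code m u).
have cu : code m (rep c) = code m u.
  by rewrite /rep; case: xgetP => [v _ []//|/(_ u)]; case.
apply: (@le_trans _ _ (\sum_(k < n) rep c k * eps k w + m.+1%:R^-1 * s)).
  rewrite mulr_sumr -big_split /=; apply: ler_sum => k _.
  rewrite -lerBlDl -mulrBl; apply: le_trans (ler_norm _) _; rewrite normrM.
  by apply: ler_wpM2r => //; exact: code_near.
apply: lerD => //; apply: ub_le_sup.
  by apply: subset_has_ubound (hub w) => _ [i _ <-]; exists i.
by exists (choice.pickle c) => //; rewrite /h /dec choice.pickleK.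
Qed.

Hypothesis epsi : forall k, itg (eps k).

Lemma itg_process u n : itg (fun w => \sum_(k < n) u k * eps k w).
Proof. by apply: itg_sum => k _; exact: itgZ. Qed.

Lemma itg_process_sup n : itg (process_sup n).
Proof.
apply: itg_le (measurable_process_sup n) (process_sup_norm n) _.
by apply: itgZ; apply: itg_sum => k _; exact: itg_norm.
Qed.

Hypothesis eps_mean : forall k, \int[P]_w eps k w = 0.

(** The supremum dominates the process at one fixed member of [U], which has mean zero. *)
Lemma process_sup_mean_ge0 n : 0 <= \int[P]_w process_sup n w.
Proof.
have [u Uu] := U0; apply: (@le_trans _ _ (\int[P]_w \sum_(k < n) u k * eps k w)).
  rewrite Rintegral_sum; last by move=> k _; exact: itgZ.
  by rewrite big1 // => k _; rewrite RintegralZl // eps_mean mulr0.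
apply: le_Rintegral => //; [exact: itg_process|exact: itg_process_sup|].
by move=> w _; exact: process_sup_ge.
Qed.

Hypothesis eps_indep : mutually_independent eps.

Lemma shattered_process_sup_ge n (S : {set 'I_n}) (s : 'I_n -> R) (gamma : R) :
  (forall sigma : {ffun 'I_n -> bool}, exists2 u, U u & forall k, k \in S ->
    if sigma k then s k + gamma <= u k else u k <= s k - gamma) ->
  gamma * \sum_(k in S) \int[P]_w `|eps k w| <= \int[P]_w process_sup n w.
Proof.
move=> shat.
have [v vP] := @boolp.choice _ _ (fun (sigma : {ffun 'I_n -> bool}) (u : nat -> R) =>
    U u /\ forall k, k \in S -> if sigma k then s k + gamma <= u k else u k <= s k - gamma)
  (fun sigma => let: ex_intro2 u h1 h2 := shat sigma in ex_intro _ u (conj h1 h2)).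
(* [v (Z w)] depends only on the signs of the noise on [S], so it is independent
   of the noise at each coordinate outside [S]. *)
pose Z w : {ffun 'I_n -> bool} := [ffun k : 'I_n => (k \in S) && (0 <= eps k w)].
(* Outside [S] the word [Z w] is false, so a pattern that is true there has an empty fiber. *)
pose A (sigma : {ffun 'I_n -> bool}) (k : 'I_n) : set R :=
  if k \in S then (if sigma k then `[0, +oo[%classic else `]-oo, 0[%classic)
  else (if sigma k then set0 else setT).
have mA sigma k : measurable (A sigma k).
  by rewrite /A; case: ifP => _; case: ifP => _ //; exact: measurable_itv.
have ZE sigma : Z @^-1` [set sigma] = [set w | forall k, A sigma k (eps k w)].
  apply/seteqP; split => w /= => [<- k|H].
    rewrite /A ffunE; case: (k \in S) => //=.
    by case: lerP => h /=; rewrite in_itv /= ?h.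
  apply/ffunP => k; have := H k; rewrite /A ffunE; case: (k \in S) => /=.
    by case: (sigma k); rewrite /= in_itv /= ?andbT // leNgt => ->.
  by case: (sigma k).
have mZ sigma : measurable (Z @^-1` [set sigma]).
  by rewrite ZE; apply: measurable_box.
(* [G k] bounds the [k]-th term from below. On [S] the sign choice gains [gamma * |eps k|] over the
   threshold term [s k * eps k], whose mean is zero. *)
pose G (k : 'I_n) w := if k \in S then s k * eps k w + gamma * `|eps k w|
  else v (Z w) k * eps k w.
have Gi k : itg (G k).
  rewrite /G; case: (k \in S).
    by apply: itgD; apply: itgZ => //; exact: itg_norm.
  by apply: (itg_fin_valued mZ (F := fun j w => v j k * eps k w)) => j; exact: itgZ.
have -> : gamma * \sum_(k in S) \int[P]_w `|eps k w| =
    \int[P]_w \sum_(k < n) G k w.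
  rewrite Rintegral_sum // mulr_sumr big_mkcond /=; apply: eq_bigr => k _.
  rewrite /G; case: ifPn => kS.
    rewrite RintegralD //; first last.
    - by apply: itgZ; exact: itg_norm.
    - exact: itgZ.
    rewrite RintegralZl // eps_mean mulr0 add0r RintegralZl //.
    exact: itg_norm.
  rewrite (Rintegral_fin_valued mZ (F := fun j w => v j k * eps k w)); last first.
    by move=> j; exact: itgZ.
  rewrite big1 // => sigma _; under eq_Rintegral do rewrite mulrCA.
  rewrite RintegralZl //; last exact: itg_indic_mul.
  rewrite ZE (Rintegral_indep_event eps_indep) ?eps_mean ?mulr0 //.
  by rewrite /A (negbTE kS); case: (sigma k); [right|left].
apply: le_Rintegral => //; [exact: itg_sum|exact: itg_process_sup|].
move=> w _; have [UZ ZP] := vP (Z w).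
apply: le_trans (process_sup_ge n w UZ); apply: ler_sum => k _.
rewrite /G; case: ifPn => // kS; have := ZP k kS; rewrite ffunE kS /=.
have [e0|e0] := lerP 0 (eps k w) => h.
  by rewrite (ger0_norm e0) -mulrDl ler_wpM2r.
by rewrite (ltr0_norm e0) mulrN -mulrBl ler_wnM2r // ltW.
Qed.

End process_sup.

(** * Exponential moments and the maximum over a finite cover *)

Section upper_bound.
Context {d : measure_display} {Omega : measurableType d} {R : realType}.
Context {P : probability Omega R} (eps : nat -> {RV P >-> R}).
Hypothesis eps_indep : mutually_independent eps.
Local Notation itg f := (P.-integrable [set: Omega] (EFin \o f)).
Hypothesis epsi : forall k, itg (eps k).
Hypothesis eps_mean : forall k, \int[P]_w eps k w = 0.

(** From [expR (- y) >= 1 - y] one gets [(1 - y) * expR y <= 1], while [1 - y] times the right side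
    is at least [1] for [y <= 1 / 2]. *)
Lemma expR_le_quadratic (y : R) : y <= 1 / 2 -> expR y <= 1 + y + 2 * y ^+ 2.
Proof.
move=> y2; have h : 0 < 1 - y by lra.
have e1 : (1 - y) * expR y <= 1.
  have := expR_ge1Dx (- y); rewrite -(ler_pM2r (expR_gt0 y)) -expRD addNr expR0.
  by rewrite mulrC [1 - y]addrC addrC.
rewrite -(ler_pM2l h); apply: (le_trans e1).
have -> : (1 - y) * (1 + y + 2 * y ^+ 2) = 1 + y ^+ 2 * (1 - 2 * y) by ring.
by rewrite lerDl mulr_ge0 ?sqr_ge0 //; lra.
Qed.

Section discretized.
Context (J : finType) (a : J -> R) (idx : R -> J) (eta M B lambda : R).
Hypothesis midx : forall j, measurable (idx @^-1` [set j]).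
Hypothesis approx : forall k, \int[P]_w `|eps k w - a (idx (eps k w))| <= eta.
Hypothesis aM : forall j, `|a j| <= M.
Hypothesis lambda0 : 0 < lambda.
Hypothesis B0 : 0 <= B.
Hypothesis small : lambda * B * M <= 1 / 2.
Local Notation Y k w := (a (idx (eps k w))).

Lemma measurable_idx k j : measurable ((fun w => idx (eps k w)) @^-1` [set j]).
Proof. exact: measurable_preimage_RV (midx j). Qed.

Lemma itg_discretized (F : J -> R) k : itg (fun w => F (idx (eps k w))).
Proof.
by apply: (itg_fin_valued (@measurable_idx k) (F := fun j _ => F j)) => j; exact: itg_cst.
Qed.

Lemma discretized_mean k : `|\int[P]_w Y k w| <= eta.
Proof.
have -> : \int[P]_w Y k w = - \int[P]_w (eps k w - Y k w).
  by rewrite RintegralB // ?eps_mean ?sub0r ?opprK //; exact: itg_discretized.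
rewrite normrN; apply: le_trans (approx k); apply: le_normr_Rintegral => //.
by apply: itgB => //; exact: itg_discretized.
Qed.

(** [small] keeps the exponent within reach of the quadratic bound. The linear term leaves
    [lambda * B * eta], the discretized noise being centered only up to [eta]. *)
Lemma discretized_mgf1 (c : R) k : `|c| <= B ->
  \int[P]_w expR (lambda * (c * Y k w)) <=
  expR (lambda * B * eta + 2 * (lambda * B * M) ^+ 2).
Proof.
move=> cB.
have cY w : `|lambda * (c * Y k w)| <= lambda * B * M.
  rewrite !normrM (gtr0_norm lambda0) -mulrA ler_pM2l //.
  by apply: ler_pM.
apply: (@le_trans _ _ (\int[P]_w (1 + lambda * c * Y k w + 2 * (lambda * B * M) ^+ 2))).
  apply: le_Rintegral => //.
  - exact: (itg_discretized (fun j => expR (lambda * (c * a j)))).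
  - apply: itgD; last exact: itg_cst.
    by apply: itgD; [exact: itg_cst|apply: itgZ; exact: itg_discretized].
  move=> w _; have := cY w; rewrite ler_norml => /andP[h1 h2].
  apply: le_trans (expR_le_quadratic (le_trans h2 small)) _.
  rewrite -[lambda * c * _]mulrA lerD2l ler_pM2l // -[leLHS]real_normK ?num_real //.
  by rewrite lerXn2r // nnegrE; apply: le_trans (cY w).
rewrite RintegralD //; first last.
- exact: itg_cst.
- by apply: itgD; [exact: itg_cst|apply: itgZ; exact: itg_discretized].
rewrite RintegralD //; first last.
- by apply: itgZ; exact: itg_discretized.
- exact: itg_cst.
rewrite !Rintegral_setT_cst RintegralZl //; last exact: itg_discretized.
apply: le_trans (expR_ge1Dx _); rewrite -addrA lerD2l lerD2r -mulrA -[leRHS]mulrA ler_pM2l //.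
apply: le_trans (ler_norm _) _; rewrite normrM; apply: ler_pM => //.
exact: discretized_mean.
Qed.

Definition word n w : {ffun 'I_n -> J} := [ffun k : 'I_n => idx (eps k w)].

Lemma word_fiber n (f : {ffun 'I_n -> J}) :
  @word n @^-1` [set f] = [set w | forall k, (idx @^-1` [set f k]) (eps k w)].
Proof.
apply/seteqP; split => w /= => [<- k|H]; first by rewrite ffunE.
by apply/ffunP => k; rewrite ffunE H.
Qed.

Lemma measurable_word n (f : {ffun 'I_n -> J}) : measurable (@word n @^-1` [set f]).
Proof.
rewrite word_fiber.
exact: (@measurable_box _ _ _ _ eps n (fun k => idx @^-1` [set f k])).
Qed.

(** Independence makes the probability of a word a product; summing over words and distributing
    factors the mean into one-coordinate means. *)
Lemma discretized_mgf n (c : nat -> R) : (forall k, `|c k| <= B) ->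
  \int[P]_w expR (lambda * \sum_(k < n) c k * Y k w) <=
  expR (n%:R * (lambda * B * eta + 2 * (lambda * B * M) ^+ 2)).
Proof.
move=> cB.
have -> : \int[P]_w expR (lambda * \sum_(k < n) c k * Y k w) =
    \prod_(k < n) \int[P]_w expR (lambda * (c k * Y k w)).
  pose F (f : {ffun 'I_n -> J}) := expR (lambda * \sum_(k < n) c k * a (f k)).
  transitivity (\int[P]_w F (@word n w)).
    apply: eq_Rintegral => w _; rewrite /F; congr (expR (_ * _)).
    by apply: eq_bigr => k _; rewrite ffunE.
  rewrite (Rintegral_fin_valued_cst (@measurable_word n)).
  transitivity (\prod_(k < n) \sum_j fine (P ((fun w => idx (eps k w)) @^-1` [set j])) *
      expR (lambda * (c k * a j))); last first.
    apply: eq_bigr => k _.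
    by rewrite -(Rintegral_fin_valued_cst (@measurable_idx k)
      (fun j => expR (lambda * (c k * a j)))).
  rewrite bigA_distr_bigA /=; apply: eq_bigr => f _.
  rewrite big_split /= word_fiber.
  have -> := independent_box eps_indep
    (A := fun k : 'I_n => idx @^-1` [set f k]) (fun k => midx (f k)).
  congr (_ * _).
  by rewrite /F mulr_sumr expR_sum.
rewrite expRM_natl -[n in X in _ <= X]card_ord -prodr_const; apply: ler_prod => k _.
by rewrite discretized_mgf1 // andbT Rintegral_ge0 // => w _; exact: expR_ge0.
Qed.

Context (U : set (nat -> R)).
Hypothesis U0 : U !=set0.
Hypothesis UB : forall u k, U u -> `|u k| <= B.

Lemma process_sup_cover_le n m (c : 'I_m -> nat -> R) (rho : R) :
  (forall i, U (c i)) ->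
  (forall u, U u -> exists i, \sum_(k < n) `|u k - c i k| <= rho * n%:R) ->
  \int[P]_w process_sup eps U n w <=
    n%:R * (2 * B * eta + M * rho + 2 * lambda * (B * M) ^+ 2)
      + (ln m%:R + 1) / lambda.
Proof.
move=> cU cover.
have m0 : (0 < m)%N.
  by have [u /cover[i _]] := U0; apply: leq_ltn_trans (ltn_ord i).
have M0 : 0 <= M by apply: le_trans (aM (idx 0)); exact: normr_ge0.
(* The maximum of the [S i] is at most [t + sum_i exp(lambda (S i - t)) / lambda],
   and [t] makes the mean of the last sum at most [1]. *)
pose e1 := lambda * B * eta + 2 * (lambda * B * M) ^+ 2.
pose t := (ln m%:R + n%:R * e1) / lambda.
pose S i w := \sum_(k < n) c i k * Y k w.
pose G w := B * \sum_(k < n) `|eps k w - Y k w| + M * rho * n%:R + t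
  + expR (- lambda * t) / lambda * \sum_(i < m) expR (lambda * S i w).
have supG w : process_sup eps U n w <= G w.
  apply: process_sup_le => // u Uu; have [i ui] := cover u Uu.
  (* Three errors to bound separately: discretization of the noise, distance to the center, and the
     discretized process at the center. *)
  have -> : \sum_(k < n) u k * eps k w = \sum_(k < n) u k * (eps k w - Y k w)
      + \sum_(k < n) (u k - c i k) * Y k w + S i w.
    by rewrite -!big_split /=; apply: eq_bigr => k _; ring.
  rewrite /G -[X in _ <= X]addrA; apply: lerD; first apply: lerD.
  - rewrite mulr_sumr; apply: ler_sum => k _; apply: le_trans (ler_norm _) _.
    by rewrite normrM ler_wpM2r // UB.
  - rewrite -mulrA; apply: le_trans (ler_wpM2l M0 ui); rewrite mulr_sumr.
    apply: ler_sum => k _; apply: le_trans (ler_norm _) _.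
    by rewrite normrM mulrC ler_wpM2r.
  (* Uses [x <= expR x] at [x = lambda * (S i w - t)]. *)
  - rewrite -lerBlDl -(ler_pM2l lambda0) mulrA [lambda * (_ / _)]mulrC divfK ?gt_eqF //.
    rewrite (bigD1 i) //= [leRHS]mulrDr.
    apply: (@le_trans _ _ (expR (- lambda * t) * expR (lambda * S i w))).
      rewrite -expRD; apply: le_trans (expR_ge1Dx _).
      by rewrite mulrBr mulNr [- _ + _]addrC lerDr.
    by rewrite lerDl mulr_ge0 ?expR_ge0 // sumr_ge0 // => j _; exact: expR_ge0.
have Ei i : itg (fun w => expR (lambda * S i w)).
  pose F (f : {ffun 'I_n -> J}) := expR (lambda * \sum_(k < n) c i k * a (f k)).
  have H : itg (fun w => F (@word n w)).
    apply: (itg_fin_valued (@measurable_word n) (F := fun f _ => F f)) => f.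
    exact: itg_cst.
  apply: (itg_ext _ H) => w; congr (expR (_ * _)).
  by apply: eq_bigr => k _; rewrite ffunE.
have Di k : itg (fun w => `|eps k w - Y k w|).
  by apply: itg_norm; apply: itgB => //; exact: itg_discretized.
have i1 : itg (fun w => B * \sum_(k < n) `|eps k w - Y k w|) by apply: itgZ; exact: itg_sum.
have i2 : itg (fun w => B * \sum_(k < n) `|eps k w - Y k w| + M * rho * n%:R).
  by apply: itgD => //; exact: itg_cst.
have i3 : itg (fun w => B * \sum_(k < n) `|eps k w - Y k w| + M * rho * n%:R + t).
  by apply: itgD => //; exact: itg_cst.
have i4 : itg (fun w => expR (- lambda * t) / lambda * \sum_(i < m) expR (lambda * S i w)).
  by apply: itgZ; exact: itg_sum.
apply: (@le_trans _ _ (\int[P]_w G w)).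
  apply: le_Rintegral => //; [exact: (itg_process_sup U0 UB)|exact: itgD].
rewrite /G RintegralD // RintegralD //; last exact: itg_cst.
rewrite RintegralD //; last exact: itg_cst.
rewrite !Rintegral_setT_cst !RintegralZl //; [|exact: itg_sum..].
rewrite !Rintegral_sum //.
have h1 : \sum_(k < n) \int[P]_w `|eps k w - Y k w| <= n%:R * eta.
  apply: (@le_trans _ _ (\sum_(k < n) eta)); first by apply: ler_sum => k _; exact: approx.
  by rewrite sumr_const card_ord mulr_natl.
have h2 : \sum_(i < m) \int[P]_w expR (lambda * S i w) <= m%:R * expR (n%:R * e1).
  apply: (@le_trans _ _ (\sum_(i < m) expR (n%:R * e1))).
    by apply: ler_sum => i _; apply: discretized_mgf => k; exact: UB.
  by rewrite sumr_const card_ord [leRHS]mulr_natl.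
have h3 : expR (- lambda * t) / lambda *
    \sum_(i < m) \int[P]_w expR (lambda * S i w) <= lambda^-1.
  have := ler_wpM2l (expR_ge0 (- lambda * t)) h2.
  have -> : expR (- lambda * t) * (m%:R * expR (n%:R * e1)) = 1.
    rewrite -[m%:R]lnK ?posrE ?ltr0n // -!expRD -[RHS]expR0; congr expR.
    by rewrite /t; field; rewrite gt_eqF.
  by move=> h; rewrite mulrAC -[leRHS]mul1r ler_pM2r ?invr_gt0.
apply: le_trans (lerD (lerD (lerD (ler_wpM2l B0 h1) (lexx _)) (lexx _)) h3) _.
rewrite /t /e1 le_eqVlt; apply/orP; left; apply/eqP; field; by rewrite gt_eqF.
Qed.

End discretized.
End upper_bound.

(** * From subexponential covers to a sublinear mean supremum *)

Section subexponential_covers.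
Context {d : measure_display} {Omega : measurableType d} {R : realType}.
Context {P : probability Omega R} (eps : nat -> {RV P >-> R}).
Local Notation itg f := (P.-integrable [set: Omega] (EFin \o f)).
Hypothesis eps_ident : identically_distributed eps.

Lemma identical_mean (f : R -> R) j k : measurable_fun [set: R] f ->
  (forall x, 0 <= f x) -> \int[P]_w f (eps j w) = \int[P]_w f (eps k w).
Proof.
move=> mf f0.
have mEf : measurable_fun [set: R] (EFin \o f) by exact/measurable_EFinP.
have E i : (\int[P]_w (f (eps i w))%:E = \int[distribution P (eps i)]_x (f x)%:E)%E.
  by rewrite ge0_integral_distribution // => x; rewrite lee_fin.
by rewrite /Rintegral !E; congr fine; apply: eq_measure_integral => A mA _; exact: eps_ident.
Qed.

Hypothesis eps_indep : mutually_independent eps.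
Hypothesis epsi : forall k, itg (eps k).
Hypothesis eps_mean : forall k, \int[P]_w eps k w = 0.
Context (U : set (nat -> R)) (B : R).
Hypothesis U0 : U !=set0.
Hypothesis UB : forall u k, U u -> `|u k| <= B.

Lemma process_sup_sublinear :
  (forall rho c : R, 0 < rho -> 0 < c -> \forall n \near \oo,
    exists (m : nat) (v : 'I_m -> nat -> R), [/\ forall i, U (v i),
      (forall u, U u -> exists i, \sum_(k < n) `|u k - v i k| <= rho * n%:R) &
      m%:R <= expR (c * n%:R)]) ->
  forall e : R, 0 < e -> \forall n \near \oo, \int[P]_w process_sup eps U n w <= e * n%:R.
Proof.
move=> covers e e0.
have B0 : 0 <= B by have [u Uu] := U0; apply: le_trans (UB 0%N Uu).
(* One fifth for each of the noise discretization, the cover radius, the quadratic term,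
   [ln m%:R / lambda] and [1 / lambda]. *)
pose e5 := e / 5; have e50 : 0 < e5 by rewrite divr_gt0.
pose eta := e5 / (2 * (B + 1)).
have eta0 : 0 < eta by rewrite divr_gt0 // mulr_gt0 // ltr_wpDl.
have [J [a [idx [midx approx0]]]] := simple_approximation (epsi 0) eta0.
(* The noise is identically distributed, so one discretization serves every coordinate. *)
have approx k : \int[P]_w `|eps k w - a (idx (eps k w))| <= eta.
  rewrite (@identical_mean (fun x => `|x - a (idx x)|) k 0%N) //.
  apply: measurableT_comp => //; apply: measurable_funB => //.
  rewrite (_ : (fun x => a (idx x)) = fun x => \sum_j \1_(idx @^-1` [set j]) x * a j).
    by apply: measurable_sum => j; apply: measurable_funM => //; exact: measurable_indic.
  apply/funext => x /=; rewrite (bigD1 (idx x)) //= big1 ?addr0.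
    by rewrite indicE mem_set ?mul1r.
  by move=> j jx; rewrite indicE memNset ?mul0r // => /= xj; rewrite xj eqxx in jx.
pose M := \sum_j `|a j| + 1.
have M0 : 0 < M by rewrite ltr_wpDl // sumr_ge0.
have aM j : `|a j| <= M.
  rewrite /M (bigD1 j) //= -addrA lerDl addr_ge0 // sumr_ge0 //.
pose K := B * M; have K0 : 0 <= K by rewrite mulr_ge0 // ltW.
(* The first bound gives [small], the second [smallK]; the added ones avoid a zero denominator when
   [K = 0]. *)
pose lambda := Num.min (1 / (2 * (K + 1))) (e5 / (2 * (K ^+ 2 + 1))).
have K1 : 0 < K + 1 by rewrite ltr_wpDl.
have K2 : 0 < K ^+ 2 + 1 by rewrite ltr_wpDl // sqr_ge0.
have lambda0 : 0 < lambda by rewrite lt_min !divr_gt0 // mulr_gt0.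
have small : lambda * B * M <= 1 / 2.
  have : lambda <= 1 / (2 * (K + 1)) by rewrite ge_min lexx.
  rewrite ler_pdivlMr ?mulr_gt0 // -mulrA -/K; nra.
have smallK : 2 * lambda * K ^+ 2 <= e5.
  have : lambda <= e5 / (2 * (K ^+ 2 + 1)) by rewrite ge_min lexx orbT.
  rewrite ler_pdivlMr ?mulr_gt0 //; nra.
have rho0 : 0 < e5 / M by rewrite divr_gt0.
have c0 : 0 < lambda * e5 by rewrite mulr_gt0.
near=> n.
have [m [v [vU vcov mc]]] : exists (m : nat) (v : 'I_m -> nat -> R), [/\ forall i, U (v i),
      (forall u, U u -> exists i, \sum_(k < n) `|u k - v i k| <= e5 / M * n%:R) &
      m%:R <= expR (lambda * e5 * n%:R)].
  by near: n; exact: covers.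
have m0 : (0 < m)%N.
  by have [u /vcov[i _]] := U0; apply: leq_ltn_trans (ltn_ord i).
have ln_n : (ln m%:R + 1) / lambda <= (e5 + e5) * n%:R.
  rewrite mulrDl mulrDl; apply: lerD.
    rewrite ler_pdivrMr // -ler_expR lnK ?posrE ?ltr0n //.
    by have -> : e5 * n%:R * lambda = lambda * e5 * n%:R by ring.
  rewrite -ler_pdivrMl //; near: n; exact: nbhs_infty_ger.
apply: le_trans (process_sup_cover_le eps_indep epsi eps_mean midx approx aM
  lambda0 B0 small U0 UB vU vcov) _.
apply: le_trans (lerD (lexx _) ln_n) _.
rewrite [n%:R * _]mulrC -mulrDl ler_wpM2r //.
have -> : M * (e5 / M) = e5 by rewrite mulrC divfK // gt_eqF.
have h : 2 * B * eta <= e5.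
  rewrite /eta mulrA ler_pdivrMr; last by rewrite mulr_gt0 // ltr_wpDl.
  nra.
have -> : e = e5 + e5 + e5 + e5 + e5 by rewrite /e5; field.
rewrite -/K; lra.
Unshelve. all: by end_near. Qed.

End subexponential_covers.

(** * Moments of the standard normal law *)

Section normal_moments.
Context {R : realType}.
Local Notation mu := (@lebesgue_measure R).

(** The Radon-Nikodym derivative of the normal law and its density have equal integrals over all
    measurable sets, so they agree almost everywhere. *)
Lemma ge0_integral_normal_prob (m s : R) (f : R -> \bar R) :
  measurable_fun [set: R] f -> (forall x, 0 <= f x)%E ->
  (\int[normal_prob m s]_x f x = \int[mu]_x (f x * (normal_pdf m s x)%:E))%E.
Proof.
move=> mf f0.
have dom := @normal_prob_dominates R m s.
rewrite -(Radon_Nikodym_SigmaFinite.change_of_variables dom f0 measurableT mf).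
have mpdf : measurable_fun [set: R] (fun x => (normal_pdf m s x)%:E).
  by apply/measurable_EFinP; exact: measurable_normal_pdf.
have RNi := Radon_Nikodym_SigmaFinite.f_integrable dom.
apply: ae_eq_integral => //.
- by apply: emeasurable_funM => //; have /integrableP[] := RNi.
- exact: emeasurable_funM.
have : ae_eq mu setT (Radon_Nikodym_SigmaFinite.f (normal_prob m s) mu)
    (fun x => (normal_pdf m s x)%:E).
  apply: integral_ae_eq => // E _ mE.
  by rewrite -Radon_Nikodym_SigmaFinite.f_integral.
by apply: filterS => x /= /(_ I) ->.
Qed.

Lemma normal_pdfN (x : R) : normal_pdf 0 1 (- x) = normal_pdf 0 1 x.
Proof. by rewrite !normal_pdfE ?oner_neq0 // /normal_fun !subr0 sqrrN. Qed.

(** The density is even and Lebesgue measure is invariant under reflection. *)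
Lemma ge0_integral_normal_probN (f : R -> \bar R) :
  measurable_fun [set: R] f -> (forall x, 0 <= f x)%E ->
  (\int[normal_prob 0 1]_x f (- x)%R = \int[normal_prob 0 1]_x f x)%E.
Proof.
move=> mf f0; have mN : measurable_fun [set: R] (fun x => f (- x)%R).
  exact: measurableT_comp.
rewrite !ge0_integral_normal_prob //.
under eq_integral do rewrite -normal_pdfN.
set g := fun x : measurableTypeR R => (f x * (normal_pdf 0 1 x)%:E)%E.
transitivity (\int[mu]_x (g \o (-%R : measurableTypeR R -> measurableTypeR R)) x)%E => //.
have mg : measurable_fun setT g.
  by apply: emeasurable_funM => //; apply/measurable_EFinP; exact: measurable_normal_pdf.
rewrite -[in LHS](preimage_setT (-%R : measurableTypeR R -> measurableTypeR R)).
rewrite -ge0_integral_pushforward //.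
  by apply: eq_measure_integral => A mA _; exact: lebesgue_measureN.
by move=> x _; rewrite /g mule_ge0 // lee_fin normal_pdf_ge0.
Qed.

Lemma measurable_abs_EFin : measurable_fun [set: R] (fun x : R => `|x|%:E).
Proof. by apply/measurable_EFinP; exact: normr_measurable. Qed.

Lemma integral_normal_prob_abs : (\int[@normal_prob R 0 1]_x `|x|%:E < +oo)%E.
Proof.
rewrite ge0_integral_normal_prob //; last exact: measurable_abs_EFin.
(* [|x| <= exp x + exp (- x)], and multiplying the density by [exp (s x)],
   [s = 1, -1], gives [exp (1 / 2)] times the density centered at [s]. *)
pose g (m x : R) := ((expR (1 / 2))%:E * (normal_pdf m 1 x)%:E)%E.
have mg m : measurable_fun [set: R] (g m).
  apply: emeasurable_funM => //; apply/measurable_EFinP; exact: measurable_normal_pdf.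
have g0 m x : (0 <= g m x)%E by rewrite mule_ge0 // lee_fin ?expR_ge0 ?normal_pdf_ge0.
have gE m : (\int[mu]_x g m x = (expR (1 / 2))%:E)%E.
  rewrite ge0_integralZl //= ?integral_normal_pdf ?mule1 ?lee_fin ?expR_ge0 //.
    by apply/measurable_EFinP; exact: measurable_normal_pdf.
  by move=> x _; rewrite lee_fin normal_pdf_ge0.
apply: (@le_lt_trans _ _ (\int[mu]_x (g 1%R x + g (-1)%R x))%E); last first.
  have -> : (\int[mu]_x (g 1%R x + g (-1)%R x) =
      \int[mu]_x g 1%R x + \int[mu]_x g (-1)%R x)%E by apply: ge0_integralD => //; exact: mg.
  by rewrite !gE -EFinD ltry.
apply: ge0_le_integral => //.
- by move=> x _; rewrite mule_ge0 // lee_fin normal_pdf_ge0.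
- apply: emeasurable_funM; first exact: measurable_abs_EFin.
  by apply/measurable_EFinP; exact: measurable_normal_pdf.
- exact: (emeasurable_funD (mg 1%R) (mg (-1)%R)).
move=> x _; rewrite /g -!EFinM -EFinD lee_fin.
have pdfE (s : R) : s ^+ 2 = 1 ->
    expR (1 / 2) * normal_pdf s 1 x = expR (s * x) * normal_pdf 0 1 x.
  move=> s1; rewrite !normal_pdfE ?oner_neq0 // /normal_fun mulrCA [RHS]mulrCA; congr (_ * _).
  rewrite -!expRD; congr expR; rewrite subr0 expr1n sqrrB s1 -[1 *+ 2]/(1 + 1); by field.
rewrite !pdfE ?expr1n ?sqrrN ?expr1n // -mulrDl ler_wpM2r ?normal_pdf_ge0 // mul1r mulN1r.
have := expR_ge1Dx x; have := expR_ge1Dx (- x); have := expR_ge0 x; have := expR_ge0 (- x).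
by have [x0|x0] := lerP 0 x; [rewrite (ger0_norm x0)|rewrite (ltr0_norm x0)]; lra.
Qed.

Section standard_normal.
Context {d : measure_display} {Omega : measurableType d}.
Context {P : probability Omega R} (Y : {RV P >-> R}).
Hypothesis Y01 : standard_normal Y.
Local Notation itg f := (P.-integrable [set: Omega] (EFin \o f)).

Lemma standard_normal_transfer (f : R -> \bar R) :
  measurable_fun [set: R] f -> (forall x, 0 <= f x)%E ->
  (\int[P]_w f (Y w) = \int[normal_prob 0 1]_x f x)%E.
Proof.
move=> mf f0.
(* [normal_prob] is a measure on [measurableTypeR R], which has the Borel sets of
   [R] under another display. *)
have mY : measurable_fun [set: Omega] (Y : Omega -> measurableTypeR R).
  by move=> mT A mA; exact: (@measurable_funPT _ _ _ _ Y mT A mA).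
pose mixY := isMeasurableFun.Build _ _ _ _ (Y : Omega -> measurableTypeR R) mY.
pose Y' := MeasurableFun.Pack (MeasurableFun.Class mixY).
transitivity (\int[distribution P Y']_x f x)%E; first by rewrite ge0_integral_distribution.
by apply: eq_measure_integral => A mA _; exact: Y01.
Qed.

Lemma standard_normal_itg : itg Y.
Proof.
apply/integrableP; split; first exact/measurable_EFinP.
rewrite (standard_normal_transfer (f := fun x => `|x|%:E)) //; last exact: measurable_abs_EFin.
exact: integral_normal_prob_abs.
Qed.

(** Reflection is available for nonnegative integrands, so it is applied to [|x| + x], which it
    turns into [|x| - x]; equal means then force mean zero. *)
Lemma standard_normal_mean : \int[P]_w Y w = 0.
Proof.
have Yi := standard_normal_itg.
have h : \int[P]_w (`|Y w| + Y w) = \int[P]_w (`|Y w| - Y w).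
  pose f x : \bar R := (`|x| + x)%:E.
  have mf : measurable_fun [set: R] f.
    by apply/measurable_EFinP; apply: measurable_funD => //; exact: measurableT_comp.
  have f0 x : (0 <= f x)%E by rewrite lee_fin; have := ler_norm (- x); rewrite normrN; lra.
  congr fine; rewrite (standard_normal_transfer mf f0) -ge0_integral_normal_probN //.
  rewrite -standard_normal_transfer //; last exact: measurableT_comp.
  by apply: eq_integral => w _; rewrite /f normrN.
move: h; rewrite RintegralD ?RintegralB //; last exact: itg_norm; last exact: itg_norm.
lra.
Qed.

(** Otherwise [Y] vanishes almost surely, whereas the normal law, dominated by Lebesgue measure,
    gives no mass to [0]. *)
Lemma standard_normal_abs_gt0 : 0 < \int[P]_w `|Y w|.
Proof.
rewrite lt_neqAle Rintegral_ge0 // andbT eq_sym; apply/eqP => Y0.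
have Yi := standard_normal_itg.
have : (\int[P]_w `|(Y w)%:E| = 0)%E.
  rewrite -[LHS]fineK; first by rewrite -[RHS]/(0%:E) -Y0.
  by apply: integrable_fin_num => //; exact: integrable_abse.
have [H _] := @ae_eq_integral_abs _ _ _ P setT measurableT (EFin \o Y) (measurable_int _ Yi).
move=> /H [N [mN PN0 YN]].
have m0 : measurable ([set 0] : set R) by [].
have C0 : P (Y @^-1` ~` [set 0]) = 0%E.
  apply/eqP; rewrite eq_le measure_ge0 andbT -PN0; apply: le_measure; rewrite ?inE //.
    by apply: measurable_funPTI; exact: measurableC.
  by move=> w /= Yw; apply: YN => /= h; apply: Yw; have [] := h I.
have : @normal_prob R 0 1 (~` [set 0]) = 1%E.
  rewrite probability_setC // [X in (1 - X)%E](_ : _ = 0%E) ?sube0 //.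
  have /null_content_dominatesP := @normal_prob_dominates R 0 1.
  by apply; [exact: m0|exact: lebesgue_measure_set1].
rewrite -(Y01 (measurableC m0)); have -> : distribution P Y (~` [set 0]) = 0%E by exact: C0.
by move/eqP; rewrite eq_sym onee_eq0.
Qed.

End standard_normal.
End normal_moments.

(** * Vanishing entropy *)

Section entropy_zero.
Context {R : realType}.
Implicit Types (U : set (nat -> R)) (u v : nat -> R) (p : \bar R) (r c : R).

Lemma limn_esup_inf (u : (\bar R)^nat) : limn_esup u = ereal_inf (range (esups u)).
Proof. by rewrite limn_esup_lim; apply/cvg_lim => //; exact: cvg_esups_inf. Qed.

Lemma limn_esup_lt_near (u : (\bar R)^nat) (a : \bar R) :
  (limn_esup u < a)%E -> \forall n \near \oo, (u n < a)%E.
Proof.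
rewrite limn_esup_inf => /ereal_inf_lt[_ [N _ <-] uN]; exists N => // n /= Nn.
by apply: le_lt_trans uN; apply: ereal_sup_ubound; exists n.
Qed.

Lemma limn_esup_near_le (u : (\bar R)^nat) (a : \bar R) :
  (\forall n \near \oo, (u n <= a)%E) -> (limn_esup u <= a)%E.
Proof.
move=> [N _ uN]; rewrite limn_esup_inf; apply: ge_ereal_inf.
exists (esups u N); first by exists N.
by apply: ge_ereal_sup => _ [n /= Nn <-]; exact: uN.
Qed.

Lemma entropy_at_anti U p r s : r <= s -> (entropy_at U p s <= entropy_at U p r)%E.
Proof.
move=> rs; rewrite /entropy_at !limn_esup_lim; apply: lee_lim.
- exact: is_cvg_esups.
- exact: is_cvg_esups.
apply: nearW => n; apply: ge_ereal_sup => _ [k nk <-].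
apply: (@le_trans _ _ ((k%:R^-1)%:E * lne (covering_number U r k p))%E).
  apply: lee_wpmul2l; first by rewrite lee_fin.
  by rewrite lee_lne ?in_itv/= ?covering_number_ge0 ?leey// covering_number_anti.
by apply: ereal_sup_ubound; exists k.
Qed.

(** By monotonicity in the radius, the limit at zero is a supremum. *)
Lemma entropy_at_le_seq_entropy U p r : 0 < r -> (entropy_at U p r <= seq_entropy U p)%E.
Proof.
move=> r0; rewrite /seq_entropy.
have H := @nonincreasing_at_right_cvge R (entropy_at U p) 0 +oo%O isT
  (fun x y _ _ xy => entropy_at_anti U p xy).
rewrite (cvg_lim _ H) //; apply: ereal_sup_ubound; exists r => //.
by rewrite /= in_itv /= r0.
Qed.

Lemma covering_number_ge1 U r n p : U !=set0 -> (1 <= covering_number U r n p)%E.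
Proof.
move=> [u Uu]; apply: le_ereal_inf_tmp => _ [m [v Uv] <-]; rewrite lee_fin ler1n.
by have [i _ _] := Uv u Uu; apply: leq_ltn_trans (ltn_ord i).
Qed.

Lemma seq_entropy0_covering U p : seq_entropy U p = 0%E -> forall r c, 0 < r -> 0 < c ->
  \forall n \near \oo, (covering_number U r n p < (expR (c * n%:R))%:E)%E.
Proof.
move=> h0 r c r0 c0.
have : (entropy_at U p r < c%:E)%E.
  by apply: (le_lt_trans (entropy_at_le_seq_entropy U p r0)); rewrite h0 lte_fin.
move=> /limn_esup_lt_near; apply: filterS2 (nbhs_infty_gt 0) => n n0.
have n0R : 0 < n%:R :> R by rewrite ltr0n.
have := covering_number_ge0 U r n p; case: (covering_number U r n p) => [x| |] //.
  rewrite lee_fin le_eqVlt => /predU1P[<- _|x0]; first by rewrite lte_fin expR_gt0.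
  by rewrite lne_EFin // -EFinM !lte_fin ltr_pdivrMl // mulrC -ltr_expR lnK.
by move=> _; rewrite /= gt0_muley ?lte_fin ?invr_gt0 // ltNge leey.
Qed.

(** Nonemptiness makes covering numbers at least one, hence the entropy at each radius nonnegative;
    the covers give the other bound. *)
Lemma covering_seq_entropy0 U p : U !=set0 ->
  (forall r c, 0 < r -> 0 < c ->
    \forall n \near \oo, (covering_number U r n p <= (expR (c * n%:R))%:E)%E) ->
  seq_entropy U p = 0%E.
Proof.
move=> U0 cov.
have at0 r : 0 < r -> entropy_at U p r = 0%E.
  move=> r0; apply/eqP; rewrite eq_le; apply/andP; split; last first.
    rewrite /entropy_at limn_esup_inf; apply: le_ereal_inf_tmp => _ [N _ <-].
    apply: (@le_trans _ _ ((N%:R^-1)%:E * lne (covering_number U r N p))%E).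
      by apply: mule_ge0; rewrite ?lee_fin // lne_ge0 covering_number_ge1.
    by apply: ereal_sup_ubound; exists N => /=.
  apply/lee_addgt0Pr => c c0; rewrite add0e; apply: limn_esup_near_le.
  have := cov r c r0 c0; apply: filterS2 (nbhs_infty_gt 0) => n n0 h.
  rewrite lee_pdivrMl ?ltr0n // -EFinM mulrC.
  rewrite -[X in (_ <= X)%E]expeRK lee_lne // in_itv /= ?leey ?andbT.
    exact: covering_number_ge0.
  by rewrite lee_fin expR_ge0.
apply: lim_near_cst => //.
by near=> r; apply: at0; near: r; exact: nbhs_right_gt.
Unshelve. all: by end_near. Qed.

(** A comparison with the distance for exponent one; for finite [p] a pointwise inequality stands in
    for convexity and costs the factor [2]. *)
Lemma seq_dist_sum n p u v r : (1 <= p)%E -> 0 < r -> seq_dist n p u v < r ->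
  \sum_(k < n) `|u k - v k| <= 2 * r * n%:R.
Proof.
move=> p1 r0; case: n => [|n]; first by rewrite big_ord0 mulr0.
have n0 : 0 < n.+1%:R :> R by rewrite ltr0n.
case: p p1 => [q| |] //= q1.
  rewrite lee_fin in q1; have q0 : 0 < q by exact: lt_le_trans q1.
  move=> dr; have Sr : \sum_(k < n.+1) `|u k - v k| `^ q <= n.+1%:R * r `^ q.
    rewrite -ler_pdivrMl // leNgt; apply/negP => /ltW rS; move: dr; apply/negP.
    have rE : r = (r `^ q) `^ q^-1 by rewrite -powRrM mulfV ?gt_eqF // powRr1 // ltW.
    rewrite -leNgt [leLHS]rE.
    apply: ge0_ler_powR; rewrite ?invr_ge0 ?(ltW q0) ?nnegrE ?powR_ge0 //.
    exact: le_trans (powR_ge0 _ _) rS.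
  (* [x <= r] or [x = x^q x^(1-q) <= x^q r^(1-q)] *)
  have young (x : R) : 0 <= x -> x <= r + x `^ q * r `^ (1 - q).
    move=> x0; have [xr|rx] := lerP x r.
      by apply: (le_trans xr); rewrite lerDl mulr_ge0 // powR_ge0.
    have xp : 0 < x := lt_trans r0 rx.
    apply: (@le_trans _ _ (x `^ q * r `^ (1 - q))); last by rewrite lerDr ltW.
    rewrite -[1 - q]opprB powRN ler_pdivlMr ?powR_gt0 //.
    rewrite -[X in X * _]powRr1 ?(ltW xp) //.
    have -> : x `^ q = x `^ 1 * x `^ (q - 1).
      by rewrite -powRD ?(gt_eqF xp) ?implybT //; congr powR; ring.
    rewrite ler_pM2l ?powR_gt0 //; apply: ge0_ler_powR;
      by rewrite ?nnegrE ?subr_ge0 ?(ltW xp) ?(ltW r0) ?(ltW rx).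
  apply: (@le_trans _ _ (\sum_(k < n.+1) (r + `|u k - v k| `^ q * r `^ (1 - q)))).
    by apply: ler_sum => k _; exact: young.
  rewrite big_split /= sumr_const card_ord -mulr_suml.
  have : (\sum_(k < n.+1) `|u k - v k| `^ q) * r `^ (1 - q) <= n.+1%:R * r `^ q * r `^ (1 - q).
    by rewrite ler_wpM2r // powR_ge0.
  rewrite -mulrA -powRD ?(gt_eqF r0) ?implybT // subrKC powRr1 ?(ltW r0) // -[r *+ _]mulr_natr.
  by move=> h; nra.
move=> dr; apply: (@le_trans _ _ (\sum_(k < n.+1) r)).
  by apply: ler_sum => k _; apply: ltW; apply: le_lt_trans dr; exact: le_bigmax.
rewrite sumr_const card_ord -[r *+ _]mulr_natr ler_pM2r //; lra.
Qed.

(** The exponential-moment bound needs centers bounded by [B], so each is replaced by a member of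
    [U] in its ball. This doubles the radius, and [seq_dist_sum] doubles it again. *)
Lemma internal_cover U r n p c : (1 <= p)%E -> 0 < r -> U !=set0 ->
  (covering_number U r n p < (expR c)%:E)%E ->
  exists (m : nat) (v : 'I_m -> nat -> R), [/\ forall i, U (v i),
    (forall u, U u -> exists i, \sum_(k < n) `|u k - v i k| <= 4 * r * n%:R) &
    m%:R <= expR c].
Proof.
move=> p1 r0 [u0 Uu0] /ereal_inf_lt[_ [m [a Ua] <-]]; rewrite lte_fin => mc.
(* A ball that misses [U] gets the center [u0]. *)
pose v i := xget u0 [set u | U u /\ seq_dist n p (a i) u < r].
exists m, v; split; last exact: ltW.
  by move=> i; rewrite /v; case: xgetP => // u _ [].
move=> u Uu; have [i _ /= ui] := Ua u Uu; exists i.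
have [_ vi] : U (v i) /\ seq_dist n p (a i) (v i) < r.
  by rewrite /v; case: xgetP => [w _ //|/(_ u)]; case.
have h1 := seq_dist_sum p1 r0 ui; have h2 := seq_dist_sum p1 r0 vi.
apply: (@le_trans _ _ (\sum_(k < n) (`|a i k - u k| + `|a i k - v i k|))).
  apply: ler_sum => k _; rewrite [X in _ <= X + _]distrC.
  by apply: le_trans (ler_normD _ _); rewrite addrA subrK.
by rewrite big_split /=; nra.
Qed.

End entropy_zero.

(** * Width and entropy *)

Section bounded_sequences.
Context {d : measure_display} {Omega : measurableType d} {R : realType}.
Context {P : probability Omega R} (eps : nat -> {RV P >-> R}).
Hypothesis eps_indep : mutually_independent eps.
Hypothesis eps_ident : identically_distributed eps.
Hypothesis epsi : forall k, P.-integrable [set: Omega] (EFin \o eps k).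
Hypothesis eps_mean : forall k, \int[P]_w eps k w = 0.
Context (U : set (nat -> R)) (B : R) (p : \bar R).
Hypothesis U0 : U !=set0.
Hypothesis UB : forall u k, U u -> `|u k| <= B.
Hypothesis p1 : (1 <= p)%E.

Lemma seq_entropy0_sublinear : seq_entropy U p = 0%E ->
  forall e : R, 0 < e -> \forall n \near \oo, \int[P]_w process_sup eps U n w <= e * n%:R.
Proof.
move=> h0; apply: (process_sup_sublinear eps_ident eps_indep epsi eps_mean U0 UB).
move=> rho c rho0 c0; have r0 : 0 < rho / 4 by rewrite divr_gt0.
apply: filterS (seq_entropy0_covering h0 r0 c0) => n /(internal_cover p1 r0 U0).
have -> : 4 * (rho / 4) = rho by field.
by [].
Qed.

Lemma sublinear_seq_entropy0 : 0 < \int[P]_w `|eps 0%N w| ->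
  (forall e : R, 0 < e -> \forall n \near \oo, \int[P]_w process_sup eps U n w <= e * n%:R) ->
  seq_entropy U p = 0%E.
Proof.
move=> nondeg small; apply: covering_seq_entropy0 => // r c r0 c0.
pose eta := r / 2; have eta0 : 0 < eta by rewrite divr_gt0.
have -> : r = 2 * eta by rewrite /eta; field.
have [alpha a0 dich] := covering_or_shattering B eta0 c0.
set m1 := \int[P]_w _ in nondeg.
(* Half the growth rate that shattering forces on the mean supremum. *)
pose e := eta / 2 * alpha * m1 / 2.
have e0 : 0 < e by rewrite divr_gt0 // !mulr_gt0 // divr_gt0.
apply: filterS3 (nbhs_infty_gt 0) (small e e0) dich => n n0 small_n.
move=> /(_ U p p1 UB) [//|[tau alpha_tau shat]].
(* The midpoint of level [l], shifted back by [B]: a sequence whose level is strictly above or below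
   [l] is at least [eta / 2] away on that side. *)
pose s (k : 'I_n) : R := eta * (if tau k is Some l then l%:R + 1 / 2 else 0) - B.
have := @shattered_process_sup_ge _ _ _ P eps U B U0 UB epsi eps_mean eps_indep n
  (patsupp tau) s (eta / 2).
have -> : \sum_(k in patsupp tau) \int[P]_w `|eps k w| = #|patsupp tau|%:R * m1.
  rewrite (eq_bigr (fun _ => m1)) ?sumr_const ?mulr_natl // => k _.
  exact: (identical_mean eps_ident k 0%N).
move=> H; exfalso; have {}H : eta / 2 * (#|patsupp tau|%:R * m1) <= e * n%:R.
  apply: le_trans small_n; apply: H => sigma.
  have [u Uu /forallP ut] := shat sigma; exists u => // k; rewrite inE => tk.
  have := ut k; rewrite /s; case: (tau k) tk => // l _.
  have /andP[] := levelP eta0 (UB k Uu).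
  set x := level B eta n u k; case: (sigma k) => lo hi.
    by rewrite -(ler_nat R) -natr1 => /(ler_wpM2l (ltW eta0)); lra.
  by rewrite -(ler_nat R) => /(ler_wpM2l (ltW eta0)); lra.
have n0R : 0 < n%:R :> R by rewrite ltr0n.
have : eta / 2 * (alpha * n%:R * m1) <= eta / 2 * (#|patsupp tau|%:R * m1).
  by rewrite ler_pM2l ?divr_gt0 // ler_pM2r.
have : 0 < eta / 2 * (alpha * n%:R * m1) by rewrite !mulr_gt0 // divr_gt0.
have -> : eta / 2 * (alpha * n%:R * m1) = 2 * (e * n%:R) by rewrite /e; field.
by lra.
Qed.

End bounded_sequences.

(** * Orbit sequences of a family of dynamical models *)

Section dynamics.
Context {R : realType} {Theta X : metricType R} (D : dynFamily Theta X).
Hypothesis Theta_compact : compact [set: Theta].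
Hypothesis X_compact : compact [set: X].

(** All terms are values of one continuous observable on the compact product of [Theta] and [X]. *)
Lemma orbit_seqs_bounded : exists B : R, forall u k, orbit_seqs D u -> `|u k| <= B.
Proof.
have cTX : compact [set: Theta * X] by rewrite -setXTT; exact: compact_setX.
have := continuous_compact (continuous_subspaceT (@dyn_obs_continuous _ _ _ D)) cTX.
move=> /compact_bounded[M [_ HM]]; exists (M + 1) => u k [theta [x ->]].
apply: (HM (M + 1)); first by rewrite ltrDl.
by exists (theta, iter k (dyn_map D theta) x).
Qed.

Context {d : measure_display} {Omega : measurableType d}.
Context {P : probability Omega R} (eps : nat -> {RV P >-> R}).

Lemma width_process_sup n : width D eps n = process_sup eps (orbit_seqs D) n.
Proof.
apply/funext => w; congr sup; apply/seteqP; split => s /=.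
  by move=> [x [theta ->]]; exists (orbit_seq D theta x) => //; exists theta, x.
by move=> [u [theta [x ->]] ->]; exists x, theta.
Qed.

Hypothesis Theta_nonempty : [set: Theta] !=set0.
Hypothesis X_nonempty : [set: X] !=set0.

Lemma orbit_seqs_nonempty : orbit_seqs D !=set0.
Proof.
have [theta _] := Theta_nonempty; have [x _] := X_nonempty.
by exists (orbit_seq D theta x), theta, x.
Qed.

Hypothesis epsi : forall k, P.-integrable [set: Omega] (EFin \o eps k).
Hypothesis eps_mean : forall k, \int[P]_w eps k w = 0.

(** The means are nonnegative, so convergence to zero amounts to a sublinear upper bound. *)
Lemma is_mean_width0 : is_mean_width D eps 0%E <->
  forall e : R, 0 < e ->
    \forall n \near \oo, \int[P]_w process_sup eps (orbit_seqs D) n w <= e * n%:R.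
Proof.
have [B UB] := orbit_seqs_bounded; have U0 := orbit_seqs_nonempty.
have E n : mean_width_upto D eps n = (\int[P]_w process_sup eps (orbit_seqs D) n w)%:E.
  rewrite /mean_width_upto unlock width_process_sup /Rintegral fineK //.
  apply: integrable_fin_num => //; exact: (itg_process_sup U0 UB).
rewrite /is_mean_width; under eq_fun do rewrite E -EFinM.
split => [cv e e0|small].
  have e0' : (0 < e%:E)%E by rewrite lte_fin.
  have := cv _ (open_ereal_lt' e0'); apply: filterS2 (nbhs_infty_gt 0) => n n0 /=.
  by rewrite lte_fin ltr_pdivrMl ?ltr0n // mulrC => /ltW.
apply/fine_cvgP; split; first exact: nearW.
apply/cvgrPdist_le => e e0; have := small e e0.
apply: filterS2 (nbhs_infty_gt 0) => n n0 h /=.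
rewrite sub0r normrN ger0_norm ?ler_pdivrMl ?ltr0n // 1?mulrC //.
by rewrite mulr_ge0 // (process_sup_mean_ge0 U0 UB).
Qed.

End dynamics.

(** * Integrability of centered noise of finite variance *)

Section finite_variance.
Context {d : measure_display} {Omega : measurableType d} {R : realType}.
Context {P : probability Omega R} (Y : {RV P >-> R}).
Hypothesis Y_mean : ('E_P[Y] = 0)%E.

(** With mean zero the variance is the second moment, and [|y| <= 1 + y ^+ 2]. *)
Lemma centered_finite_variance_itg : ('V_P[Y] < +oo)%E ->
  P.-integrable [set: Omega] (EFin \o Y).
Proof.
have -> : 'V_P[Y]%E = (\int[P]_w ((Y w ^+ 2)%:E))%E.
  rewrite /variance covariance.unlock Y_mean expectation.unlock /=.
  apply: eq_integral => w _.
  by have -> : Y w ^+ 2 = (Y w - 0) * (Y w - 0) by rewrite subr0.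
move=> V; apply/integrableP; split; first exact/measurable_EFinP.
have mY2 : measurable_fun [set: Omega] (fun w => (Y w ^+ 2)%:E).
  by apply/measurable_EFinP; exact: measurable_funX.
apply: (@le_lt_trans _ _ (\int[P]_w (1 + (Y w ^+ 2)%:E))%E).
  apply: ge0_le_integral => //.
  - by apply: measurableT_comp => //; exact/measurable_EFinP.
  - exact: emeasurable_funD.
  - move=> w _; rewrite -EFinD lee_fin.
    have : 0 <= (`|Y w| - 1) ^+ 2 by exact: sqr_ge0.
    by rewrite -[Y w ^+ 2]real_normK ?num_real // sqrrB; have := normr_ge0 (Y w); nra.
rewrite ge0_integralD //; last by move=> w _; rewrite lee_fin sqr_ge0.
rewrite integral_cst // mul1e lte_add_pinfty //.
by apply: (@le_lt_trans _ _ 1%E); [exact: probability_le1|exact: ltry].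
Qed.

Lemma expectation0_Rintegral : \int[P]_w Y w = 0.
Proof. by move: Y_mean; rewrite unlock /Rintegral => ->. Qed.

End finite_variance.

Theorem theorem4p7 (R : realType) (Theta X : metricType R)
  (Theta_nonempty : [set: Theta] !=set0) (Theta_compact : compact [set: Theta])
  (X_nonempty : [set: X] !=set0) (X_compact : compact [set: X])
  (D : dynFamily Theta X) (p : \bar R) (p_ge1 : (1 <= p)%E) :
  (forall (d : measure_display) (Omega : measurableType d)
     (P : probability Omega R) (eps : nat -> {RV P >-> R}),
     iid eps ->
     (forall k : nat, ('E_P[eps k] = 0)%E) ->
     (forall k : nat, ('V_P[eps k] < +oo)%E) ->
     dyn_entropy D p = 0%E -> is_mean_width D eps 0%E)
  /\
  (forall (d : measure_display) (Omega : measurableType d)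
     (P : probability Omega R) (eps : nat -> {RV P >-> R}),
     iid eps ->
     (forall k : nat, standard_normal (eps k)) ->
     (is_mean_width D eps 0%E <-> dyn_entropy D p = 0%E)).
Proof.
have U0 := orbit_seqs_nonempty D Theta_nonempty X_nonempty.
have [B UB] := orbit_seqs_bounded D Theta_compact X_compact.
split=> d Omega P eps [eps_indep eps_ident].
  move=> mean0 var h0.
  have epsi k := centered_finite_variance_itg (mean0 k) (var k).
  have eps_mean k := expectation0_Rintegral (mean0 k).
  apply/is_mean_width0 => //.
  exact: (seq_entropy0_sublinear eps_indep eps_ident epsi eps_mean U0 UB p_ge1).
move=> normal.
have epsi k := standard_normal_itg (normal k).
have eps_mean k := standard_normal_mean (normal k).
rewrite is_mean_width0 //; split.
  apply: (sublinear_seq_entropy0 eps_indep eps_ident epsi eps_mean U0 UB p_ge1).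
  exact: standard_normal_abs_gt0.
exact: (seq_entropy0_sublinear eps_indep eps_ident epsi eps_mean U0 UB p_ge1).
Qed.
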